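(* Let $\mu\in\mathcal P_\lambda$ be non-degenerate and assume there exists a non-degenerate $\mu_{\mathrm G}\in\mathcal P_{\mathrm G}$ with $\operatorname{KL}(\mu,\mu_{\mathrm G})<\infty$. Let $\nu\in\mathcal P_{\mathrm G}$ be non-degenerate. Then $\operatorname{KL}(\mu,\mathcal{GP}(\mu))<\infty$ and $$\operatorname{KL}(\mu,\nu)-\operatorname{KL}(\mu,\mathcal{GP}(\mu))=\mathcal G(\mu,\nu).$$
   Context: Take $\mathcal X=\mathcal Y=\mathbb R$. Let $I$ be the set of all finite tuples $\mathbf x=(x_1,\dots,x_n)\in\mathbb R^n$, $n\ge1$, of pairwise distinct inputs, and $P_{\mathbf x}f=(f(x_1),\dots,f(x_n))$. $\mathcal P$ denotes the probability measures on $\mathbb R^{\mathbb R}$ with the cylindrical $\sigma$-algebra; $P_{\mathbf x}\mu$ is the finite-dimensional distribution of $\mu$ at $\mathbf x$. $\mathcal P^n$: Borel probability measures on $\mathbb R^n$; $\mathcal P^n_{\mathrm G}$: Gaussian ones (possibly singular); $\mathcal P_{\mathrm G}$: Gaussian processes. $\mathcal P_\lambda$: processes all of whose finite-dimensional distributions at $\mathbf x\in I$ have a Lebesgue density. A distribution on $\mathbb R^n$ is non-degenerate if it has a strictly positive definite covariance matrix; a process is non-degenerate if all its finite-dimensional distributions at $\mathbf x\in I$ are. $\mathcal{GP}(\mu)$ is the Gaussian process with the same mean and covariance function as $\mu$. For processes, $\operatorname{KL}(\mu,\nu)=\sup_{\mathbf x\in I}\operatorname{KL}(P_{\mathbf x}\mu,P_{\mathbf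 x}\nu)$. Gaussian divergence: for $\mu\in\mathcal P^n$, $\nu\in\mathcal P^n_{\mathrm G}$, $\mathcal G(\mu,\nu)=\operatorname{KL}(\mu,\nu)-\inf_{\xi\in\mathcal P^n_{\mathrm G}}\operatorname{KL}(\mu,\xi)$ if this infimum is finite, and $\infty$ otherwise; for $\mu\in\mathcal P$, $\nu\in\mathcal P_{\mathrm G}$, $\mathcal G(\mu,\nu)=\sup_{\mathbf x\in I}\mathcal G(P_{\mathbf x}\mu,P_{\mathbf x}\nu)$. *)

(* Defs.v *)
From HB Require Import structures.
From mathcomp Require Import all_boot all_order all_algebra.
From mathcomp Require Import all_classical all_reals all_analysis.

Set Implicit Arguments.
Unset Strict Implicit.
Unset Printing Implicit Defensive.

Import Order.TTheory GRing.Theory Num.Theory.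
Import numFieldNormedType.Exports.

Local Open Scope classical_set_scope.
Local Open Scope ring_scope.

Definition cyl_display : measure_display.
Proof. exact: default_measure_display. Qed.

Definition cylR (R : realType) : Type := R -> R.

Section cylinder.
Variable R : realType.

HB.instance Definition _ := Pointed.on (cylR R).

Definition cyl_sets : set (set (cylR R)) :=
  <<s \bigcup_(x in [set: R])
        preimage_set_system [set: cylR R] (fun f : cylR R => f x) measurable >>.

Let cyl_set0 : cyl_sets set0.
Proof. exact: sigma_algebra0. Qed.

Let cyl_setC A : cyl_sets A -> cyl_sets (~` A).
Proof. exact: sigma_algebraC. Qed.

Let cyl_bigcup (F : (set (cylR R))^nat) : (forall i, cyl_sets (F i)) ->
  cyl_sets (\bigcup_i (F i)).
Proof. exact: sigma_algebra_bigcup. Qed.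

HB.instance Definition _ := @isMeasurable.Build cyl_display (cylR R)
  cyl_sets cyl_set0 cyl_setC cyl_bigcup.

End cylinder.

Local Open Scope ereal_scope.

Fixpoint lebn (R : realType) (n : nat) : set (n.-tuple R) -> \bar R :=
  match n return set (n.-tuple R) -> \bar R with
  | 0%N => fun A => (\1_A [tuple] : R)%:E
  | m.+1 => fun A =>
      \int[@lebesgue_measure R]_x @lebn R m [set t : m.-tuple R | A [tuple of (x : R) :: t]]
  end.

Definition has_lebesgue_density (R : realType) (n : nat)
    (P : set (n.-tuple R) -> \bar R) : Prop :=
  exists p : n.-tuple R -> R,
    measurable_fun [set: n.-tuple R] p /\ (forall t, (0 <= p t)%R) /\
    forall A, measurable A -> P A = \int[@lebn R n]_(t in A) (p t)%:E.

Definition is_density d (T : measurableType d) (R : realType)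
    (P Q : set T -> \bar R) (f : T -> R) : Prop :=
  measurable_fun [set: T] f /\ (forall x, (0 <= f x)%R) /\
  forall A, measurable A -> P A = \int[Q]_(x in A) (f x)%:E.

Definition KL d (T : measurableType d) (R : realType)
    (P Q : set T -> \bar R) : \bar R :=
  match pselect (exists f, is_density P Q f) with
  | left h => \int[P]_x (ln (sval (cid h) x))%:E
  | right _ => +oo
  end.

Definition lin_fun (R : realType) (n : nat) (a : n.-tuple R) :
  n.-tuple R -> R := fun t => (\sum_(i < n) tnth a i * tnth t i)%R.

Definition is_gaussian (R : realType) (n : nat) (P : set (n.-tuple R) -> \bar R)
    : Prop :=
  forall a : n.-tuple R,
    (exists m s : R, (0 < s)%R /\
       forall B, measurable B -> pushforward P (lin_fun a) B = normal_prob m s B)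
    \/
    (exists m : R,
       forall B, measurable B -> pushforward P (lin_fun a) B = \d_m B).

Definition fd_mean (R : realType) (n : nat) (P : set (n.-tuple R) -> \bar R)
    (i : 'I_n) : R := fine (\int[P]_t (tnth t i)%:E).

Definition fd_cov (R : realType) (n : nat) (P : set (n.-tuple R) -> \bar R)
    (i j : 'I_n) : R :=
  fine (\int[P]_t ((tnth t i - fd_mean P i) * (tnth t j - fd_mean P j))%:E).

Definition fd_nondegenerate (R : realType) (n : nat)
    (P : set (n.-tuple R) -> \bar R) : Prop :=
  (forall i : 'I_n, P.-integrable [set: n.-tuple R] (fun t => ((tnth t i) ^+ 2)%:E))
  /\ forall v : n.-tuple R, (exists i, tnth v i != 0%R) ->
       (0 < \sum_(i < n) \sum_(j < n) tnth v i * fd_cov P i j * tnth v j)%R.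

Definition gauss_div (R : realType) (n : nat)
    (P Q : set (n.-tuple R) -> \bar R) : \bar R :=
  let inf := ereal_inf [set KL P (xi : set (n.-tuple R) -> \bar R) |
                        xi in [set xi : probability (n.-tuple R) R | is_gaussian xi]] in
  if inf \is a fin_num then KL P Q - inf else +oo.

Definition in_I (R : realType) (n : nat) (x : n.-tuple R) : Prop :=
  (0 < n)%N /\ uniq x.

Definition evalt (R : realType) (n : nat) (x : n.-tuple R) : cylR R -> n.-tuple R :=
  fun f => map_tuple f x.

Definition fdd (R : realType) (n : nat) (x : n.-tuple R)
    (mu : set (cylR R) -> \bar R) : set (n.-tuple R) -> \bar R :=
  pushforward mu (evalt x).

Definition gauss_process (R : realType) (mu : probability (cylR R) R) : Prop :=
  forall n (x : n.-tuple R), in_I x -> is_gaussian (fdd x mu).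

Definition lebesgue_process (R : realType) (mu : probability (cylR R) R) : Prop :=
  forall n (x : n.-tuple R), in_I x -> has_lebesgue_density (fdd x mu).

Definition nondegenerate_process (R : realType) (mu : probability (cylR R) R)
  : Prop :=
  forall n (x : n.-tuple R), in_I x -> fd_nondegenerate (fdd x mu).

Definition KLp (R : realType) (mu nu : probability (cylR R) R) : \bar R :=
  ereal_sup [set y | exists n (x : n.-tuple R),
                in_I x /\ y = KL (fdd x mu) (fdd x nu)].

Definition gauss_div_p (R : realType) (mu nu : probability (cylR R) R) : \bar R :=
  ereal_sup [set y | exists n (x : n.-tuple R),
                in_I x /\ y = gauss_div (fdd x mu) (fdd x nu)].

Definition p_mean (R : realType) (mu : probability (cylR R) R) (x : R) : R :=
  fine (\int[mu]_f (f x)%:E).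

Definition p_cov (R : realType) (mu : probability (cylR R) R) (x y : R) : R :=
  fine (\int[mu]_f ((f x - p_mean mu x) * (f y - p_mean mu y))%:E).

Definition is_GP_of (R : realType) (mu xi : probability (cylR R) R) : Prop :=
  gauss_process xi /\
  (forall x, p_mean xi x = p_mean mu x) /\
  (forall x y, p_cov xi x y = p_cov mu x y).

(* Main.v *)
(* Let P, G, Q be the laws at x of mu, GP(mu) and nu. Any two non-degenerate Gaussian laws
   have a mutual density of the form exp(q) with q a quadratic polynomial. As P and G have the
   same first two moments, the integral of q = ln (dG/dQ) is the same under P and under G,
   which gives KL(P, Q) = KL(P, G) + KL(G, Q). Hence the infimum of KL(P, .) over the Gaussian
   laws is attained at G, and G(P, Q) = KL(G, Q). Both KL(P, G) and KL(G, Q) grow with x by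
   the data processing inequality, and the set of inputs is directed, so the supremum of
   their sum is the sum of their suprema.

   The density exp(q) is obtained without densities on R^n: tilting a Gaussian law by an
   exponential of a quadratic function of one linear form gives a Gaussian law again, with
   covariance changed by a rank one matrix, and two non-degenerate Gaussian laws can be
   tilted in this way to the same one. Laws are identified by their one-dimensional
   projections (Cramer-Wold), through a polynomial approximation of indicators by
   trigonometric sums. *)
Require Import Defs.
From HB Require Import structures.
From mathcomp Require Import all_boot all_order all_algebra.
From mathcomp Require Import all_classical all_reals all_analysis.
From mathcomp Require Import measurable_realfun.
From mathcomp Require Import ring lra.

Set Implicit Arguments.
Unset Strict Implicit.
Unset Printing Implicit Defensive.

Import Order.TTheory GRing.Theory Num.Theory.
Import numFieldNormedType.Exports.

Local Open Scope classical_set_scope.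
Local Open Scope ring_scope.

(** * Densities and the Kullback-Leibler divergence *)

(** [is_gaussian] only prescribes the law of each linear form, so a Gaussian law comes with no
    density, determinant or inverse covariance to compute with. This is why tilts act along one
    linear form at a time: every form [b] splits as [c a + w] with [w] uncorrelated with the tilted
    form [a], hence independent of it, and the tilt leaves the [w] part alone. Rank one terms are
    only added with nonnegative weights, which keeps covariances positive definite; therefore
    neither law is tilted into the other, and both are moved up to a common one. Two finiteness
    issues remain. The infimum in the Gaussian divergence also ranges over singular Gaussian laws,
    which have to be excluded before the identity between the divergences applies. And finiteness of
    [KL(mu, GP(mu))] at every input tuple does not bound the supremum: the bound comes from the same
    identity with [mu_G] in place of [nu], which gives [KL(mu, GP(mu)) <= KL(mu, mu_G)] at each
    tuple. *)

Section density.
Local Open Scope ereal_scope.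
Context d (T : measurableType d) (R : realType).

Section tilt.
Variables (Q : {measure set T -> \bar R}) (f : T -> R).
Hypotheses (mf : measurable_fun [set: T] f) (f0 : forall x, (0 <= f x)%R)
  (f1 : \int[Q]_x (f x)%:E = 1).

(* The proof arguments are there for the measure instances on [tilt] to depend on. *)
Definition tilt (_ : measurable_fun [set: T] f) (_ : forall x, (0 <= f x)%R)
  (_ : \int[Q]_x (f x)%:E = 1) (A : set T) := \int[Q]_(x in A) (f x)%:E.

Local Notation nu := (tilt mf f0 f1).

Let nu0 : nu set0 = 0. Proof. by rewrite /tilt integral_set0. Qed.

Let nu_ge0 A : 0 <= nu A.
Proof. by apply: integral_ge0 => x _; rewrite lee_fin. Qed.

Let nu_sigma : semi_sigma_additive nu.
Proof.
by apply: semi_sigma_additive_nng_induced => [|x]; [exact/measurable_EFinP|rewrite lee_fin].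
Qed.

HB.instance Definition _ := isMeasure.Build _ _ _ nu nu0 nu_ge0 nu_sigma.

Let nuT : nu setT = 1. Proof. exact: f1. Qed.

HB.instance Definition _ := @Measure_isProbability.Build _ _ R nu nuT.

Lemma tilt_exists : exists P : probability T R, is_density P Q f.
Proof. by exists nu; split. Qed.

End tilt.

Section change_of_variables.
Variables (P Q : {measure set T -> \bar R}) (f : T -> R).
Hypothesis dens : is_density P Q f.

Import HBNNSimple.

Let mf : measurable_fun [set: T] f. Proof. by case: dens. Qed.
Let f0 x : (0 <= f x)%R. Proof. by case: dens => _ []. Qed.
Let Pf A : measurable A -> P A = \int[Q]_(x in A) (f x)%:E.
Proof. by case: dens => _ [_]; apply. Qed.

(** Both sides are monotone limits along the simple functions [h n] increasing to [g], and on a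
    level set of [h n] the claim is the definition of a density. *)
Lemma ge0_integral_density (g : T -> \bar R) : measurable_fun [set: T] g ->
  (forall x, 0 <= g x) -> \int[P]_x g x = \int[Q]_x (g x * (f x)%:E).
Proof.
move=> mg g0.
pose h := nnsfun_approx measurableT mg.
have hg x : (EFin \o (h ^~ x)) n @[n --> \oo] --> g x.
  by apply: (cvg_nnsfun_approx measurableT mg) => // y _; exact: g0.
have mh n : measurable_fun setT (EFin \o h n) by exact/measurable_EFinP.
have hnd x : {homo (fun n => (h n x)%:E) : a b / (a <= b)%N >-> a <= b}.
  by move=> a b ab; rewrite lee_fin; exact/lefP/nd_nnsfun_approx.
transitivity (lim (\int[P]_x (EFin \o h n) x @[n --> \oo])).
  rewrite -monotone_convergence//; last 2 first.
  - by move=> n x _; rewrite lee_fin.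
  - by move=> x _; exact: hnd.
  by apply: eq_integral => x _; apply/esym/cvg_lim => //; exact: hg.
transitivity (lim (\int[Q]_x ((h n x)%:E * (f x)%:E) @[n --> \oo])); last first.
  rewrite -monotone_convergence//.
  - apply: eq_integral => x _; apply/cvg_lim => //.
    by apply: cvgeZr; [|exact: hg].
  - by move=> n; apply: emeasurable_funM => //; exact/measurable_EFinP.
  - by move=> n x _; rewrite mule_ge0 ?lee_fin.
  - by move=> x _ a b ab; rewrite lee_wpmul2r ?lee_fin//; exact/lefP/nd_nnsfun_approx.
congr (limn _); apply/funext => n.
under eq_integral do rewrite /= fimfunE -fsumEFin//.
rewrite ge0_integral_fsum//; last 2 first.
  - by move=> r; apply/measurable_EFinP; exact: measurable_funM.
  - by move=> m y _; exact: nnfun_muleindic_ge0.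
under [RHS]eq_integral => x xT.
  rewrite fimfunE -fsumEFin// ge0_mule_fsuml; last first.
    by move=> y; exact: nnfun_muleindic_ge0.
  over.
rewrite ge0_integral_fsum//; last 2 first.
  - move=> r; apply: emeasurable_funM; last exact/measurable_EFinP.
    by apply/measurable_EFinP; exact: measurable_funM.
  - by move=> m y _; rewrite mule_ge0 ?lee_fin// -lee_fin nnfun_muleindic_ge0.
apply: eq_fsbigr => r /[!inE] -[t _ rE].
have r0 : (0 <= r)%R by rewrite -rE.
have mr : measurable (h n @^-1` [set r]) by [].
under eq_integral do rewrite EFinM.
rewrite ge0_integralZl//; last exact/measurable_EFinP.
rewrite integral_indic// setIT Pf//.
under [RHS]eq_integral do rewrite EFinM -muleA.
rewrite [RHS]ge0_integralZl//; last 2 first.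
- by apply/measurable_EFinP; exact: measurable_funM.
- by move=> x _; rewrite mule_ge0 ?lee_fin.
congr (_ * _); rewrite integral_mkcond; apply: eq_integral => x _.
by rewrite epatch_indic muleC.
Qed.

Lemma ge0_integral_density_in (A : set T) (g : T -> \bar R) : measurable A ->
  measurable_fun [set: T] g -> (forall x, 0 <= g x) ->
  \int[P]_(x in A) g x = \int[Q]_(x in A) (g x * (f x)%:E).
Proof.
move=> mA mg g0; rewrite [LHS]integral_mkcond ge0_integral_density.
- rewrite [RHS]integral_mkcond; apply: eq_integral => x _.
  by rewrite !patchE; case: ifP; rewrite ?mul0e.
- by apply/(measurable_restrictT _ mA); exact: measurable_funTS.
- by move=> x; rewrite erestrict_ge0// => y _.
Qed.

End change_of_variables.

Lemma is_density_trans (P Q N : {measure set T -> \bar R}) (f g : T -> R) :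
  is_density P Q f -> is_density Q N g -> is_density P N (f \* g)%R.
Proof.
move=> [mf [f0 Pf]] QN; have [mg [g0 _]] := QN.
split; first exact: measurable_funM.
split=> [x|A mA]; first by rewrite mulr_ge0.
rewrite Pf// (ge0_integral_density_in QN)//.
exact/measurable_EFinP.
Qed.

(** A density of exponential form vanishes nowhere, so its reciprocal is a density in the other
    direction without any exceptional null set. *)
Lemma is_density_expR_sym (P Q : {measure set T -> \bar R}) (q : T -> R) :
  is_density P Q (fun x => expR (q x)) -> is_density Q P (fun x => expR (- q x)).
Proof.
move=> PQ; have [me _] := PQ.
(* Only [expR \o q] is known to be measurable, so the reciprocal is obtained from it as the power
   -1. *)
have mi : measurable_fun setT (fun x => expR (- q x)).
  have -> : (fun x => expR (- q x)) = (fun x => (expR (q x)) `^ (-1))%R.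
    by apply/funext => x; rewrite expRN powR_inv1 ?expR_ge0.
  exact: measurableT_comp (measurable_powR _) me.
split=> //; split=> [x|A mA]; first exact: expR_ge0.
rewrite (ge0_integral_density_in PQ)//; last exact/measurable_EFinP.
under eq_integral do rewrite -EFinM -expRD addNr expR0.
by rewrite integral_cst// mul1e.
Qed.

End density.

Section kullback_leibler.
Local Open Scope ereal_scope.
Context d (T : measurableType d) (R : realType).
Implicit Types (P Q : probability T R) (f g h : T -> R).

Lemma ln_le_sub1 (x : R) : (0 < x -> ln x <= x - 1)%R.
Proof. by move=> x0; rewrite -{1}(subrKC 1%R x) le_ln1Dx// ltrBrDl subrr. Qed.

Lemma ae_le_integral (P : {measure set T -> \bar R}) (f g : T -> \bar R) :
  P.-integrable setT f -> P.-integrable setT g ->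
  {ae P, forall x, f x <= g x} -> \int[P]_x f x <= \int[P]_x g x.
Proof.
move=> if_ ig [N [mN PN0 sN]].
rewrite (negligible_integral mN)// [leRHS](negligible_integral mN)//.
apply: le_integral; first exact: measurableD.
- by apply: integrableS if_ => //; exact: measurableD.
- by apply: integrableS ig => //; exact: measurableD.
- by move=> x; rewrite inE => -[_ Nx]; apply: contrapT => fg; apply: Nx; exact: sN.
Qed.

Lemma measurable_ln_comp f : measurable_fun setT f -> measurable_fun setT (@ln R \o f).
Proof. by move=> mf; apply: measurableT_comp mf; exact: measurable_ln. Qed.

(** The zero set of [f] has [P]-mass equal to the integral of 0. Hence the default value [ln 0 = 0]
    is only met on a [P]-null set. *)
Lemma density_gt0_ae P Q f : is_density P Q f -> {ae P, forall x, (0 < f x)%R}.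
Proof.
move=> [mf [f0 Pf]]; exists [set x | f x = 0%R]; split.
- by rewrite -[X in measurable X]setTI; exact: (mf measurableT [set 0%R]).
- rewrite Pf; last by rewrite -[X in measurable X]setTI; exact: (mf measurableT [set 0%R]).
  by apply: integral0_eq => x /= ->.
- by move=> x /= /negP; rewrite -leNgt => fx; apply/eqP; rewrite eq_le fx f0.
Qed.

Lemma integral_cst_prob P (c : \bar R) : \int[P]_x cst c x = c.
Proof.
transitivity (c * P setT); first exact: integral_cst.
by rewrite (@probability_setT _ _ _ P) mule1.
Qed.

Lemma integral_density1 P Q f : is_density P Q f -> \int[Q]_x (f x)%:E = 1.
Proof. by move=> [_ [_ Pf]]; rewrite -Pf ?probability_setT. Qed.

Lemma integrable_density_EFin P Q f : is_density P Q f -> Q.-integrable setT (EFin \o f).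
Proof.
move=> dens; have [mf [f0 _]] := dens; apply/integrableP; split.
  exact/measurable_EFinP.
under eq_integral do rewrite /= ger0_norm//.
by rewrite (integral_density1 dens) ltry.
Qed.

(** [KL] picks some density by choice. Two densities agree [Q]-almost everywhere, hence [P]-almost
    everywhere, so the value does not depend on the pick. *)
Lemma KL_density P Q f : is_density P Q f -> KL P Q = \int[P]_x (ln (f x))%:E.
Proof.
move=> dens; rewrite /KL; case: pselect => [h|[]]; last by exists f.
move: (svalP (cid h)); set g := sval _ => gens.
have [mf [f0 Pf]] := dens; have [mg [g0 Pg]] := gens.
have : ae_eq Q setT (EFin \o f) (EFin \o g).
  apply: integral_ae_eq => //; first exact: integrable_density_EFin dens.
    exact/measurable_EFinP.
  by move=> E _ mE; rewrite -Pf// -Pg.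
move=> [N [mN QN0 sN]].
have PN0 : P N = 0.
  rewrite Pf//; apply: null_set_integral => //.
  by apply/measurable_EFinP; exact: measurable_funTS.
apply: ae_eq_integral => //.
- by apply/measurable_EFinP; exact: measurable_ln_comp.
- by apply/measurable_EFinP; exact: measurable_ln_comp.
exists N; split => // x /= nx; apply: sN => /= e; apply: nx => _.
by case: (e Logic.I) => ->.
Qed.

Lemma measurable_inv_density P Q f : is_density P Q f ->
  measurable_fun setT (fun x => (f x)^-1)%R.
Proof.
move=> [mf [f0 _]]; under eq_fun do rewrite -powR_inv1//.
exact: measurableT_comp (measurable_powR _) mf.
Qed.

(** The integral is [Q (f > 0)], which may be less than 1: with [0^-1 = 0] the zero set of [f],
    possibly charged by [Q], contributes nothing. *)
Lemma integral_inv_density P Q f : is_density P Q f ->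
  \int[P]_x ((f x)^-1)%:E <= 1.
Proof.
move=> dens; have [mf [f0 Pf]] := dens.
have mif := measurable_inv_density dens.
rewrite (ge0_integral_density dens)//; last by move=> x; rewrite lee_fin invr_ge0.
  rewrite -(probability_setT Q) -(mul1e (Q _)) -integral_cst//.
  apply: ge0_le_integral => //.
  - by move=> x _; rewrite -EFinM lee_fin mulr_ge0 ?invr_ge0.
  - by apply: emeasurable_funM; exact/measurable_EFinP.
  - move=> x _; rewrite -EFinM lee_fin; have [->|fx] := eqVneq (f x) 0%R.
      by rewrite mulr0.
    by rewrite mulVf.
exact/measurable_EFinP.
Qed.

(** The negative part of [ln f] is at most [1 / f], whose [P]-integral is at most 1; only the
    positive part could diverge, and the premise excludes that. *)
Lemma integrable_ln_density P Q f : is_density P Q f ->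
  \int[P]_x (ln (f x))%:E < +oo -> P.-integrable setT (EFin \o (@ln R \o f)).
Proof.
move=> dens lnf; have [mf [f0 Pf]] := dens.
have mlnf : measurable_fun setT (EFin \o (@ln R \o f)).
  by apply/measurable_EFinP; exact: measurable_ln_comp.
have neg : \int[P]_x (EFin \o (@ln R \o f))^\- x <= 1.
  apply: le_trans (integral_inv_density dens).
  apply: ge0_le_integral => //.
  - exact: measurable_funeneg.
  - by apply/measurable_EFinP; exact: measurable_inv_density dens.
  - move=> x _; rewrite funenegE /= -EFin_max lee_fin ge_max invr_ge0 f0 andbT.
    have [->|fx] := eqVneq (f x) 0%R; first by rewrite ln0// oppr0 invr0.
    have fx0 : (0 < f x)%R by rewrite lt_neqAle eq_sym fx f0.
    rewrite -lnV ?posrE//; apply: le_trans (ln_le_sub1 _) _; first by rewrite invr_gt0.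
    by rewrite lerBlDr lerDl.
apply/integrableP; split => //.
under eq_integral do rewrite -[`|_|]/((abse \o (EFin \o (@ln R \o f))) _) fune_abse.
rewrite ge0_integralD//; [|exact: measurable_funepos|exact: measurable_funeneg].
have negfin : \int[P]_x (EFin \o (@ln R \o f))^\- x \is a fin_num.
  by rewrite ge0_fin_numE ?integral_ge0//; apply: le_lt_trans neg _; rewrite ltry.
have pos : \int[P]_x (EFin \o (@ln R \o f))^\+ x < +oo.
  move: lnf; rewrite -[X in X < _ -> _]/(\int[P]_x (EFin \o (@ln R \o f)) x) integralE.
  by rewrite lteBlDr// addye//; move: negfin; rewrite fin_numE => /andP[].
by rewrite lte_add_pinfty// -ge0_fin_numE// integral_ge0.
Qed.

Lemma KL_ltyP P Q : KL P Q < +oo -> exists f, is_density P Q f /\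
  P.-integrable setT (EFin \o (@ln R \o f)).
Proof.
move=> PQ; case: (pselect (exists f, is_density P Q f)) => [[f dens]|nd].
  by exists f; split=> //; apply: (integrable_ln_density dens); rewrite -(KL_density dens).
by move: PQ; rewrite /KL; case: pselect.
Qed.

(* Gibbs' inequality, from [ln u <= u - 1] with [u = h / f]. *)
Lemma gibbs P Q f h : is_density P Q f -> measurable_fun setT h ->
  (forall x, (0 <= h x)%R) -> \int[Q]_x (h x)%:E <= 1 ->
  {ae P, forall x, (0 < h x)%R} ->
  P.-integrable setT (EFin \o (@ln R \o f)) ->
  P.-integrable setT (EFin \o (@ln R \o h)) ->
  \int[P]_x (ln (h x))%:E <= \int[P]_x (ln (f x))%:E.
Proof.
move=> dens mh h0 Qh hgt0 if_ ih; have [mf [f0 Pf]] := dens.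
have minv := measurable_inv_density dens.
pose u x := (h x * (f x)^-1)%R.
have u0 x : (0 <= u x)%R by rewrite mulr_ge0 ?invr_ge0.
have mu : measurable_fun setT u by exact: measurable_funM.
have Pu : \int[P]_x (u x)%:E <= 1.
  rewrite (ge0_integral_density dens)//; last exact/measurable_EFinP.
  apply: le_trans Qh; apply: ge0_le_integral => //.
  - by move=> x _; rewrite -EFinM lee_fin mulr_ge0.
  - by apply: emeasurable_funM; exact/measurable_EFinP.
  - exact/measurable_EFinP.
  - move=> x _; rewrite -EFinM lee_fin /u; have [->|fx] := eqVneq (f x) 0%R.
      by rewrite mulr0.
    by rewrite mulfVK.
have iu : P.-integrable setT (EFin \o u).
  apply/integrableP; split; first exact/measurable_EFinP.
  under eq_integral do rewrite /= ger0_norm//.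
  by apply: le_lt_trans Pu _; rewrite ltry.
have ih1 : P.-integrable setT ((EFin \o (@ln R \o h)) \+ cst 1).
  by apply: integrableD => //; exact: finite_measure_integrable_cst.
have ifu : P.-integrable setT ((EFin \o (@ln R \o f)) \+ (EFin \o u)) by exact: integrableD.
(* The pointwise inequality is [ln h + 1 <= ln f + h / f]. As [h / f] has [P]-integral at most 1,
   the constants cancel after integration. *)
have key : \int[P]_x ((EFin \o (@ln R \o h)) \+ cst 1) x <=
           \int[P]_x ((EFin \o (@ln R \o f)) \+ (EFin \o u)) x.
  apply: ae_le_integral => //.
  have fgt0 := density_gt0_ae dens.
  apply: filterS2 fgt0 hgt0 => x fx hx /=; rewrite -!EFinD lee_fin.
  have := ln_le_sub1 (divr_gt0 hx fx); rewrite ln_div ?posrE// /u; lra.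
move: key; rewrite !integralD//; last exact: finite_measure_integrable_cst.
rewrite integral_cst_prob => key.
have : \int[P]_x (ln (h x))%:E + 1 <= \int[P]_x (ln (f x))%:E + 1.
  by apply: le_trans key _; exact: leeD2l.
by rewrite leeD2rE.
Qed.

Lemma is_density_id P : is_density P P (fun=> 1%R).
Proof.
by split; [exact: measurable_cst|split=> // A mA]; rewrite integral_cst// mul1e.
Qed.

Lemma KL_ge0 P Q : 0 <= KL P Q.
Proof.
have [->|] := eqVneq (KL P Q) +oo; first by rewrite leey.
rewrite -ltey => /KL_ltyP [f [dens if_]]; rewrite (KL_density dens).
rewrite -(@integral_cst_prob P 0) (_ : cst 0 = fun=> (ln (1 : R))%:E); last by rewrite ln1.
apply: (gibbs dens) => //.
- by rewrite -[leRHS](integral_cst_prob Q).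
- by apply: aeW => x.
- exact: (@finite_measure_integrable_cst _ _ _ P setT (ln 1)).
Qed.

(** [ln (f * expR q) = ln f + q] wherever [f > 0], so [P]-almost everywhere; both terms are
    integrable, so the integral splits. *)
Lemma KL_tilt P Q1 Q2 (q : T -> R) : is_density Q1 Q2 (expR \o q) ->
  measurable_fun setT q -> P.-integrable setT (EFin \o q) ->
  KL P Q1 < +oo -> KL P Q2 = KL P Q1 + \int[P]_x (q x)%:E.
Proof.
move=> d12 mq iq /KL_ltyP [f [dens if_]].
have [mf [f0 _]] := dens; have [me _] := d12.
have dens2 := is_density_trans dens d12.
rewrite (KL_density dens) (KL_density dens2) -integralD//.
apply: ae_eq_integral => //.
- by apply/measurable_EFinP/measurable_ln_comp; exact: measurable_funM.
- by apply/measurable_EFinP; apply: measurable_funD => //; exact: measurable_ln_comp.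
have := density_gt0_ae dens; apply: filterS => x fx _ /=.
by rewrite lnM ?posrE ?expR_gt0// expRK.
Qed.

Lemma KL_expR Q1 Q2 (q : T -> R) : is_density Q1 Q2 (expR \o q) ->
  KL Q1 Q2 = \int[Q1]_x (q x)%:E.
Proof. by move=> dens; rewrite (KL_density dens); under eq_integral do rewrite /= expRK. Qed.

End kullback_leibler.

(** * Variables with equal laws on different spaces, and data processing *)

Lemma eq_law_integral d1 (T1 : measurableType d1) d2 (T2 : measurableType d2)
    d (S : measurableType d) (R : realType) (P1 : {measure set T1 -> \bar R})
    (P2 : {measure set T2 -> \bar R}) (X1 : T1 -> S) (X2 : T2 -> S) :
  measurable_fun setT X1 -> measurable_fun setT X2 ->
  (forall B, measurable B -> P1 (X1 @^-1` B) = P2 (X2 @^-1` B)) ->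
  forall u : S -> \bar R, measurable_fun setT u ->
  (\int[P1]_x u (X1 x) = \int[P2]_x u (X2 x))%E.
Proof.
move=> mX1 mX2 P12.
have ge0 (u : S -> \bar R) : measurable_fun setT u -> (forall x, 0 <= u x)%E ->
    (\int[P1]_x u (X1 x) = \int[P2]_x u (X2 x))%E.
  move=> mu u0.
  rewrite -[LHS](@ge0_integral_pushforward _ _ _ _ _ _ mX1 P1 setT u)//.
  rewrite -[RHS](@ge0_integral_pushforward _ _ _ _ _ _ mX2 P2 setT u)//.
  by apply: eq_measure_integral => A mA _; exact: P12.
move=> u mu; rewrite integralE [RHS]integralE; congr (_ - _)%E.
- rewrite (eq_integral (fun x => u^\+%E (X1 x))); last by move=> x _; rewrite !funeposE.
  rewrite ge0//; last exact: measurable_funepos.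
  by apply: eq_integral => x _; rewrite !funeposE.
- rewrite (eq_integral (fun x => u^\-%E (X1 x))); last by move=> x _; rewrite !funenegE.
  rewrite ge0//; last exact: measurable_funeneg.
  by apply: eq_integral => x _; rewrite !funenegE.
Qed.

Lemma eq_law_integrable d1 (T1 : measurableType d1) d2 (T2 : measurableType d2)
    d (S : measurableType d) (R : realType) (P1 : {measure set T1 -> \bar R})
    (P2 : {measure set T2 -> \bar R}) (X1 : T1 -> S) (X2 : T2 -> S) :
  measurable_fun setT X1 -> measurable_fun setT X2 ->
  (forall B, measurable B -> P1 (X1 @^-1` B) = P2 (X2 @^-1` B)) ->
  forall u : S -> R, measurable_fun setT u ->
  P1.-integrable setT (EFin \o (u \o X1)) -> P2.-integrable setT (EFin \o (u \o X2)).
Proof.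
move=> mX1 mX2 P12 u mu /integrableP[_ iu]; apply/integrableP; split.
  by apply/measurable_EFinP; exact: measurableT_comp mX2.
rewrite -(eq_law_integral mX1 mX2 P12 (u := fun y => `|(u y)%:E|%E))//.
by apply: measurableT_comp => //; exact/measurable_EFinP.
Qed.

(* Gibbs' inequality for [f] and the pulled back density [g \o phi]. *)
Lemma KL_pushforward d (T : measurableType d) d' (S : measurableType d') (R : realType)
    (P Q : probability T R) (P' Q' : probability S R) (phi : T -> S) :
  measurable_fun setT phi ->
  (forall B, measurable B -> P' B = P (phi @^-1` B)) ->
  (forall B, measurable B -> Q' B = Q (phi @^-1` B)) ->
  (KL P' Q' < +oo -> KL P' Q' <= KL P Q)%E.
Proof.
(* The premise supplies a density [g] between the image laws; deriving one from a density of [P]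
   would take a conditional expectation. *)
move=> mphi P'E Q'E /KL_ltyP[g [dens' ig]].
have [->|] := eqVneq (KL P Q) +oo%E; first by rewrite leey.
rewrite -ltey => /KL_ltyP[f [dens if_]].
have [mg [g0 _]] := dens'.
have mlg : measurable_fun [set: S] (@ln R \o g) by exact: measurable_ln_comp.
have law (N : measure _ R) (N' : measure _ R) : (forall B, measurable B -> N' B = N (phi @^-1` B)) ->
    forall B, measurable B -> N' (id @^-1` B) = N (phi @^-1` B) by [].
have ilg : P.-integrable setT (EFin \o (@ln R \o (g \o phi))).
  exact: (eq_law_integrable (X1 := id) _ _ (law _ _ P'E) mlg).
rewrite (KL_density dens) (KL_density dens').
have -> : (\int[P']_y (ln (g y))%:E = \int[P]_x (ln (g (phi x)))%:E)%E.
  rewrite (eq_law_integral (X1 := id) _ mphi (law _ _ P'E) (u := fun y => (ln (g y))%:E))//.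
  exact/measurable_EFinP.
apply: (gibbs dens) => //.
- exact: measurableT_comp mphi.
- rewrite -(integral_density1 dens') (eq_law_integral (X1 := id) _ mphi (law _ _ Q'E) (u := EFin \o g))//; exact/measurable_EFinP.
- have [N [mN P'N sN]] := density_gt0_ae dens'.
  exists (phi @^-1` N); split.
  + by rewrite -[X in measurable X]setTI; exact: mphi.
  + by rewrite -P'E.
  + by move=> x /= gx; apply: sN.
Qed.

(** * Uniqueness of a law with given one-dimensional projections *)

(* Polynomials in [u] that tend pointwise on [0, 1] to the indicator of [u <= 1/2]. *)
Definition step_poly (R : realType) (k : nat) (u : R) : R :=
  (1 - u ^+ (k * k)) ^+ (2 ^ (k * k - k)).

Section step_poly.
Context {R : realType}.
Implicit Types (u y x : R) (k n : nat).

Lemma bernoulli_ge x n : 0 <= x -> 1 + n%:R * x <= (1 + x) ^+ n.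
Proof.
move=> x0; elim: n => [|n ih]; first by rewrite mul0r addr0 expr0.
rewrite exprS; apply: le_trans (ler_wpM2l _ ih); last lra.
rewrite -natr1; have : 0 <= n%:R :> R by []. nra.
Qed.

Lemma bernoulli_le x n : 0 <= x <= 1 -> 1 - n%:R * x <= (1 - x) ^+ n.
Proof.
move=> /andP[x0 x1]; elim: n => [|n ih]; first by rewrite mul0r subr0 expr0.
rewrite exprS; apply: le_trans (ler_wpM2l _ ih); last lra.
rewrite -natr1; have : 0 <= n%:R :> R by []. nra.
Qed.

Lemma step_poly_itv k u : 0 <= u <= 1 -> 0 <= step_poly k u <= 1.
Proof.
move=> /andP[u0 u1]; have uk1 : u ^+ (k * k) <= 1 by exact: exprn_ile1.
have uk0 : 0 <= u ^+ (k * k) by exact: exprn_ge0.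
by rewrite exprn_ge0 ?subr_ge0//= exprn_ile1 ?subr_ge0// gerBl.
Qed.

Lemma cvg_half_exp : (fun k => (2 : R)^-1 ^+ k) @ \oo --> (0 : R).
Proof.
by apply: cvg_expr; rewrite ger0_norm ?invr_ge0// invf_lt1// ltr1n.
Qed.

(** Put [y = u ^ (k * k)] and [N = 2 ^ (k * k - k)]. Bernoulli's inequality bounds [(1 - y) ^ N]
    below by [1 - N y], and above through [(1 - y) ^ N <= 1 / (1 + y) ^ N <= 1 / (N y)]. The
    exponents are chosen so that [N y = ((2 u) ^ k / 2) ^ k]: this is at most [2 ^ (- k)] if
    [u <= 1/2], and at least [2 ^ k] as soon as [(2 u) ^ k >= 4]. *)
Lemma cvg_step_poly u : 0 <= u <= 1 ->
  step_poly k u @[k --> \oo] --> ((u <= 2^-1)%R%:R : R).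
Proof.
move=> u01; have [u0 u1] := andP u01.
have uk1 k : u ^+ k <= 1 by exact: exprn_ile1.
have uk0 k : 0 <= u ^+ k by exact: exprn_ge0.
have leq_sq k : (k <= k * k)%N by case: k => // k; rewrite leq_pmull.
have [uh|uh] := leP u 2^-1.
  apply: (@squeeze_cvgr _ _ _ _ (fun k => 1 - 2^-1 ^+ k) (fun=> 1)); last exact: cvg_cst.
    apply: nearW => k; have /andP[_ ->] := step_poly_itv k u01; rewrite andbT.
    apply: le_trans (bernoulli_le _ _); last by rewrite uk0 uk1.
    rewrite lerB// natrX.
    apply: (@le_trans _ _ (2 ^+ (k * k - k) * 2^-1 ^+ (k * k))).
      by rewrite ler_wpM2l ?exprn_ge0// lerXn2r ?nnegrE ?invr_ge0.
    by rewrite -{2}(subnK (leq_sq k)) exprD mulrA -exprMn divff ?expr1n ?mul1r.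
  rewrite -[X in _ --> X]subr0; apply: cvgB; [exact: cvg_cst|exact: cvg_half_exp].
apply: (@squeeze_cvgr _ _ _ _ (fun=> 0) (fun k => 2^-1 ^+ k)); [|exact: cvg_cst|exact: cvg_half_exp].
have d0 : 0 < 2 * u - 1 by rewrite subr_gt0 mulrC -ltr_pdivrMr// div1r.
(* From [N] on, [k (2 u - 1) >= 3], and Bernoulli's inequality gives [(2 u) ^ k >= 4]. *)
have [N hN] : exists N : nat, 3 / (2 * u - 1) < N%:R.
  by exists (Num.trunc (3 / (2 * u - 1))).+1; exact: truncnS_gt.
near=> k; have /andP[-> _] := step_poly_itv k u01.
have kN : (N <= k)%N by near: k; exists N.
have uk : 4 <= (2 * u) ^+ k.
  rewrite -[2 * u](subrKC 1); apply: le_trans (bernoulli_ge _ (ltW d0)).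
  have : 3 <= k%:R * (2 * u - 1).
    by rewrite -ler_pdivrMr// (le_trans (ltW hN))// ler_nat.
  lra.
have Ku : 2 ^+ k <= (2 ^ (k * k - k))%:R * u ^+ (k * k).
  rewrite natrX -(@ler_pM2l _ (2 ^+ k)) ?exprn_gt0//.
  rewrite [leRHS]mulrA -[in leRHS]exprD [in leRHS]subnKC// -[leRHS]exprMn -[leLHS]exprMn.
  rewrite [leRHS]exprM lerXn2r ?nnegrE//.
  - by rewrite exprn_ge0// mulr_ge0.
  - by apply: le_trans uk; lra.
rewrite /= /step_poly exprVn -(@ler_pM2r _ (2 ^+ k)) ?exprn_gt0// mulVf ?expf_neq0//.
have y1 : 1 - u ^+ (k * k) <= (1 + u ^+ (k * k))^-1.
  rewrite -div1r ler_pdivlMr; last by rewrite ltr_pwDl.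
  have := sqr_ge0 (u ^+ (k * k)); nra.
apply: (@le_trans _ _ ((1 + u ^+ (k * k)) ^- (2 ^ (k * k - k)) * 2 ^+ k)).
  rewrite ler_wpM2r ?exprn_ge0// -exprVn lerXn2r// ?nnegrE ?subr_ge0 ?invr_ge0//.
  by rewrite addr_ge0.
rewrite mulrC ler_pdivrMr ?exprn_gt0 ?ltr_pwDl// mul1r.
by apply: le_trans Ku _; apply: le_trans (bernoulli_ge _ _) => //; rewrite lerDr.
Unshelve. all: by end_near. Qed.

End step_poly.

(** * An algebra of trigonometric test functions *)

Section trigonometric_sums.
Context {R : realType} (I : finType).

(** Each summand depends on a single linear form, so its integral is known from the one-dimensional
    projections. The product-to-sum formula keeps products in the class, which is what makes
    polynomials in its members usable; the phase [c] provides sines and constants. *)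
Inductive trig_sum : ((I -> R) -> R) -> Prop :=
| trig_sum_cos k (a : I -> R) c : trig_sum (fun x => k * cos (\sum_i a i * x i + c))
| trig_sumD f g : trig_sum f -> trig_sum g -> trig_sum (fun x => f x + g x).

Lemma trig_sum_cst c : trig_sum (fun=> c).
Proof.
rewrite (_ : (fun=> c) = fun x : I -> R => c * cos (\sum_i 0 * x i + 0)).
  exact: trig_sum_cos.
by apply/funext => x; rewrite big1 ?addr0 ?cos0 ?mulr1// => i _; rewrite mul0r.
Qed.

Lemma trig_sumM f g : trig_sum f -> trig_sum g -> trig_sum (fun x => f x * g x).
Proof.
move=> tf; elim: tf g => [k a c g|f1 f2 _ ih1 _ ih2 g tg]; last first.
  under eq_fun do rewrite mulrDl.
  by apply: trig_sumD; [exact: ih1|exact: ih2].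
elim=> [k' a' c'|g1 g2 _ ih1 _ ih2]; last first.
  by under eq_fun do rewrite mulrDr; exact: trig_sumD.
rewrite (_ : (fun x => _) = fun x =>
    (k * k' / 2) * cos (\sum_i (a i + a' i) * x i + (c + c')) +
    (k * k' / 2) * cos (\sum_i (a i - a' i) * x i + (c - c'))).
  by apply: trig_sumD; exact: trig_sum_cos.
apply/funext => x.
have -> : \sum_i (a i + a' i) * x i + (c + c') =
    (\sum_i a i * x i + c) + (\sum_i a' i * x i + c').
  by rewrite addrACA -big_split /=; congr (_ + _); apply: eq_bigr => i _; rewrite mulrDl.
have -> : \sum_i (a i - a' i) * x i + (c - c') =
    (\sum_i a i * x i + c) - (\sum_i a' i * x i + c').
  rewrite opprD addrACA -sumrB /=; congr (_ + _).
  by apply: eq_bigr => i _; rewrite mulrBl.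
move: (\sum_i a i * x i + c) (\sum_i a' i * x i + c') => A B; by rewrite cosD cosB; field.
Qed.

Lemma trig_sumX f n : trig_sum f -> trig_sum (fun x => f x ^+ n).
Proof.
move=> tf; elim: n => [|n ih]; first by under eq_fun do rewrite expr0; exact: trig_sum_cst.
by under eq_fun do rewrite exprS; exact: trig_sumM.
Qed.

Lemma trig_sum_prod (J : Type) (r : seq J) (F : J -> (I -> R) -> R) :
  (forall j, trig_sum (F j)) -> trig_sum (fun x => \prod_(j <- r) F j x).
Proof.
move=> tF; elim: r => [|j r ih].
  by under eq_fun do rewrite big_nil; exact: trig_sum_cst.
by under eq_fun do rewrite big_cons; exact: trig_sumM.
Qed.

Lemma trig_sum_sin (c : R) i : trig_sum (fun x => sin (c * x i)).
Proof.
rewrite (_ : (fun x => _) = fun x =>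
    1 * cos (\sum_j (if j == i then c else 0) * x j + (- (pi / 2)))).
  exact: trig_sum_cos.
apply/funext => x; rewrite (bigD1 i)//= eqxx big1 ?addr0 ?cosBpihalf ?mul1r//.
by move=> j /negbTE ->; rewrite mul0r.
Qed.

Lemma trig_sum_step_poly f k : trig_sum f -> trig_sum (fun x => step_poly k (f x)).
Proof.
move=> tf; apply: trig_sumX; apply: trig_sumD; first exact: trig_sum_cst.
under eq_fun do rewrite -mulN1r.
by apply: trig_sumM; [exact: trig_sum_cst|exact: trig_sumX].
Qed.

End trigonometric_sums.

Lemma cvg_prod_seq (R : realType) (J : Type) (r : seq J) (F : J -> nat -> R) (l : J -> R) :
  (forall j, F j n @[n --> \oo] --> l j) ->
  (\prod_(j <- r) F j n) @[n --> \oo] --> \prod_(j <- r) l j.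
Proof.
move=> Fl; elim: r => [|j r ih].
  by rewrite big_nil; under eq_fun do rewrite big_nil; exact: cvg_cst.
by rewrite big_cons; under eq_fun do rewrite big_cons; exact: cvgM.
Qed.

Lemma prod_itv01 (R : realType) (J : Type) (r : seq J) (F : J -> R) :
  (forall j, 0 <= F j <= 1) -> 0 <= \prod_(j <- r) F j <= 1.
Proof.
move=> F01; elim/big_ind: _ => [|x y /andP[x0 x1] /andP[y0 y1]|//].
  by rewrite ler01 lexx.
by rewrite mulr_ge0//= mulr_ile1.
Qed.

Lemma integrable_bounded d (T : measurableType d) (R : realType) (P : probability T R)
    (f : T -> R) (M : R) :
  measurable_fun setT f -> (forall t, `|f t| <= M) -> P.-integrable setT (EFin \o f).
Proof.
move=> mf fM; apply: le_integrable (finite_measure_integrable_cst P M measurableT) => //.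
  exact/measurable_EFinP.
by move=> t _ /=; rewrite lee_fin (le_trans (fM t))// ler_norm.
Qed.

Section cramer_wold.
Context {R : realType} (I : finType).
Context d1 (T1 : measurableType d1) d2 (T2 : measurableType d2).
Variables (P1 : probability T1 R) (P2 : probability T2 R).
Variables (X1 : I -> T1 -> R) (X2 : I -> T2 -> R).
Hypotheses (mX1 : forall i, measurable_fun setT (X1 i))
           (mX2 : forall i, measurable_fun setT (X2 i)).
Hypothesis law : forall a : I -> R, forall B, measurable B ->
  P1 ((fun t => \sum_i a i * X1 i t) @^-1` B) =
  P2 ((fun t => \sum_i a i * X2 i t) @^-1` B).

Let good (h : (I -> R) -> R) := [/\ measurable_fun setT (fun t => h (X1 ^~ t)),
  measurable_fun setT (fun t => h (X2 ^~ t)),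
  P1.-integrable setT (fun t => (h (X1 ^~ t))%:E),
  P2.-integrable setT (fun t => (h (X2 ^~ t))%:E) &
  (\int[P1]_t (h (X1 ^~ t))%:E = \int[P2]_t (h (X2 ^~ t))%:E)%E].

Let msum d (T : measurableType d) (X : I -> T -> R) (a : I -> R) :
  (forall i, measurable_fun setT (X i)) ->
  measurable_fun setT (fun t => \sum_i a i * X i t).
Proof. by move=> mX; apply: measurable_sum => i; exact: measurable_funM. Qed.

Let good_trig h : trig_sum h -> good h.
Proof.
elim=> [k a c|f g _ [mf1 mf2 if1 if2 fE] _ [mg1 mg2 ig1 ig2 gE]]; last first.
  split.
  - exact: measurable_funD.
  - exact: measurable_funD.
  - exact: (integrableD measurableT if1 ig1).
  - exact: (integrableD measurableT if2 ig2).
  - by rewrite !integralD_EFin// fE gE.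
pose u y : R := k * cos (y + c).
have mu : measurable_fun setT u.
  apply: measurable_funM => //; apply: measurableT_comp.
    exact: continuous_measurable_fun (@continuous_cos R).
  exact: measurable_funD.
have mu1 : measurable_fun setT (fun t => u (\sum_i a i * X1 i t)).
  exact: measurableT_comp mu (msum _ mX1).
have mu2 : measurable_fun setT (fun t => u (\sum_i a i * X2 i t)).
  exact: measurableT_comp mu (msum _ mX2).
have uk y : `|u y| <= `|k|.
  by rewrite normrM ler_piMr// ler_norml cos_geN1 cos_le1.
split; [exact: mu1|exact: mu2| | |].
- exact: (@integrable_bounded _ _ _ P1 _ _ mu1 (fun t => uk _)).
- exact: (@integrable_bounded _ _ _ P2 _ _ mu2 (fun t => uk _)).
- apply: (eq_law_integral (msum a mX1) (msum a mX2) (law a) (u := EFin \o u)).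
  exact/measurable_EFinP.
Qed.

Let good_lim (h_ : nat -> (I -> R) -> R) h : (forall n, good (h_ n)) ->
  (forall n x, 0 <= h_ n x <= 1) -> (forall x, h_ n x @[n --> \oo] --> h x) -> good h.
Proof.
move=> gh h01 hh.
have m1 : measurable_fun setT (fun t => h (X1 ^~ t)).
  apply: (measurable_fun_cvg (h := fun n t => h_ n (X1 ^~ t))) => //.
  by move=> n; case: (gh n).
have m2 : measurable_fun setT (fun t => h (X2 ^~ t)).
  apply: (measurable_fun_cvg (h := fun n t => h_ n (X2 ^~ t))) => //.
  by move=> n; case: (gh n).
have hh1 n x : `|h_ n x| <= 1 by have /andP[? ?] := h01 n x; rewrite ger0_norm.
have dc d (T : measurableType d) (P : probability T R) (X : I -> T -> R) :
    (forall n, measurable_fun setT (fun t => h_ n (X ^~ t))) ->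
    measurable_fun setT (fun t => h (X ^~ t)) ->
    P.-integrable setT (fun t => (h (X ^~ t))%:E) /\
    (\int[P]_t (h_ n (X ^~ t))%:E @[n --> \oo] --> \int[P]_t (h (X ^~ t))%:E)%E.
  move=> mn mh.
  have [] := @dominated_convergence _ T R P setT measurableT
    (fun n t => (h_ n (X ^~ t))%:E) (fun t => (h (X ^~ t))%:E) (cst 1%E).
  - by move=> n; exact/measurable_EFinP.
  - exact/measurable_EFinP.
  - by apply: aeW => t _; apply: cvg_EFin; [exact: nearW|exact: hh].
  - exact: finite_measure_integrable_cst.
  - by apply: aeW => t n _; rewrite lee_fin.
  - by move=> ? _ ?.
have [i1 c1] := dc _ _ P1 X1 (fun n => let: And5 a _ _ _ _ := gh n in a) m1.
have [i2 c2] := dc _ _ P2 X2 (fun n => let: And5 _ a _ _ _ := gh n in a) m2.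
split => //.
have E : (fun n => \int[P1]_t (h_ n (X1 ^~ t))%:E)%E = (fun n => \int[P2]_t (h_ n (X2 ^~ t))%:E)%E.
  by apply/funext => n; have [_ _ _ _ ->] := gh n.
by rewrite E in c1; exact: cvg_unique c1 c2.
Qed.

(** The sine increases on [[- pi/2, pi/2]], so once [N + 1] exceeds [|x i|] and [|b i|], the
    condition [x i <= b i] means [sin (c N * x i) <= sin (c N * b i)]. Two limits are taken in turn:
    in the degree of [step_poly] for fixed [N], then in [N], where the indicators are eventually
    constant at each point. *)
Theorem cramer_wold (b : I -> R) :
  P1 [set t | forall i, X1 i t <= b i] = P2 [set t | forall i, X2 i t <= b i].
Proof.
pose c (N : nat) : R := N.+1%:R^-1.
(* The difference of sines lies in [[-2, 2]]; rescaling sends it to [[0, 1]] with the sign change at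
   the threshold 1/2 of [step_poly]. *)
pose u N i (x : I -> R) := 2^-1 + (sin (c N * x i) - sin (c N * b i)) / 4.
have u01 N i x : 0 <= u N i x <= 1.
  have := sin_le1 (c N * x i); have := sin_geN1 (c N * x i).
  have := sin_le1 (c N * b i); have := sin_geN1 (c N * b i).
  rewrite /u; lra.
have g1 N : good (fun x => \prod_i (u N i x <= 2^-1)%R%:R).
  apply: (good_lim (h_ := fun k x => \prod_i step_poly k (u N i x))).
  - move=> k; apply: good_trig; apply: trig_sum_prod => i; apply: trig_sum_step_poly.
    apply: trig_sumD; first exact: trig_sum_cst.
    under eq_fun do rewrite mulrC; apply: trig_sumM; first exact: trig_sum_cst.
    by apply: trig_sumD; [exact: trig_sum_sin|exact: trig_sum_cst].
  - by move=> k x; apply: prod_itv01 => i; exact: step_poly_itv.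
  - by move=> x; apply: cvg_prod_seq => i; exact: cvg_step_poly.
have g2 : good (fun x => \prod_i (x i <= b i)%R%:R).
  apply: (good_lim g1).
  - by move=> k x; apply: prod_itv01 => i; case: (u k i x <= 2^-1); rewrite /= ?ler01 ?lexx.
  move=> x; apply: cvg_prod_seq => i; apply: cvg_near_cst.
  pose M := Num.max `|x i| `|b i|.
  have M0 : 0 <= M by rewrite le_max normr_ge0.
  near=> N.
  have MN : M <= N.+1%:R.
    apply: (@le_trans _ _ (Num.trunc M).+1%:R); first exact/ltW/truncnS_gt.
    by rewrite ler_nat ltnS; near: N; exists (Num.trunc M).
  have itv y : `|y| <= M -> c N * y \in `[- (pi / 2), pi / 2].
    move=> yM; rewrite in_itv /= -ler_norml normrM ger0_norm ?invr_ge0//.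
    apply: le_trans (pihalf_ge1 R); rewrite mulrC ler_pdivrMr// mul1r.
    exact: le_trans yM MN.
  congr (_%:R); congr nat_of_bool.
  rewrite /u gerDl pmulr_lle0 ?invr_gt0// subr_le0 leNgt ltr_sin.
  - by rewrite ltr_pM2l ?invr_gt0// -leNgt.
  - by apply: itv; rewrite le_max lexx orbT.
  - by apply: itv; rewrite le_max lexx.
have [m1 m2 _ _ gE] := g2.
have prodE (x : I -> R) : \prod_i (x i <= b i)%R%:R = [forall i, x i <= b i]%:R :> R.
  have [/forallP xb|/forallPn[i xb]] := boolP [forall i, x i <= b i].
    by rewrite big1// => i _; rewrite xb.
  by rewrite (bigD1 i)//= (negbTE xb) mul0r.
have PE d (T : measurableType d) (P : probability T R) (X : I -> T -> R) :
    measurable_fun setT (fun t => \prod_i (X i t <= b i)%R%:R : R) ->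
    (\int[P]_t (\prod_i (X i t <= b i)%R%:R)%:E = P [set t | forall i, (X i t <= b i)%R])%E.
  move=> m; have -> : [set t | forall i, X i t <= b i] =
      (fun t => \prod_i (X i t <= b i)%R%:R : R) @^-1` [set 1].
    apply/seteqP; split=> t /=; rewrite prodE.
      by move=> /forallP ->.
    by case: forallP => //= _ /eqP; rewrite eq_sym oner_eq0.
  set A := (X in P X); have mA : measurable A.
    by rewrite -[X in measurable X]setTI; exact: m.
  rewrite -[A in RHS]setIT -integral_indic//.
  apply: eq_integral => t _; congr EFin; rewrite indicE.
  have [At|nAt] := pselect (A t); first by rewrite mem_set//; exact: At.
  rewrite memNset// prodE; move: nAt; rewrite /A /= prodE.
  by case: [forall i, _].
by rewrite -!PE.
Unshelve. all: by end_near. Qed.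

End cramer_wold.

Section cramer_wold_tuple.
Context {R : realType} (n : nat).

Let boxes : set (set (n.-tuple R)) :=
  [set A | exists b : 'I_n -> R, A = [set t | forall i, tnth t i <= b i]].

(** For the inclusion into the sigma-algebra of the boxes, a half-space [tnth t i <= x] is the union
    over [k] of the boxes whose other coordinates are bounded by [k]. *)
Let boxes_measurable : @measurable _ (n.-tuple R) = <<s boxes >>.
Proof.
apply/seteqP; split => A; last first.
  apply: smallest_sub => [|_ [b ->]]; first exact: sigma_algebra_measurable.
  rewrite (_ : [set t | _] = \bigcap_(i in [set: 'I_n]) [set t : n.-tuple R | tnth t i <= b i]).
    apply: fin_bigcap_measurable => // i _.
    rewrite -[X in measurable X]setTI (_ : [set t | _] = (@tnth n R ^~ i) @^-1` `]-oo, b i]).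
      exact: measurable_tnth.
    by apply/seteqP; split => t /=; rewrite in_itv.
  by apply/seteqP; split => t h; [move=> i _; exact: h|move=> i; exact: h].
move: A; apply: smallest_sub; first exact: smallest_sigma_algebra.
pose S := g_sigma_algebraType boxes.
have mt i : measurable_fun [set: S] (fun t : S => tnth (t : n.-tuple R) i).
  apply: (measurability (@RGenOInfty.G R)); first exact: RGenOInfty.measurableE.
  move=> _ [_ [x ->] <-]; rewrite setTI.
  rewrite (_ : _ @^-1` _ = ~` [set t : S | tnth (t : n.-tuple R) i <= x]); last first.
    by apply/seteqP; split => t /=; rewrite in_itv/= andbT ltNge => /negP.
  apply: measurableC.
  rewrite (_ : [set t | _] = \bigcup_k [set t : S | forall j, tnth (t : n.-tuple R) j <=
      if j == i then x else k%:R]).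
    apply: bigcup_measurable => k _; apply: sub_sigma_algebra.
    by exists (fun j => if j == i then x else k%:R).
  apply/seteqP; split => t /=; last by move=> [k _ /(_ i)]; rewrite eqxx.
  move=> tx; pose M := \sum_j `|tnth (t : n.-tuple R) j|.
  exists (Num.trunc M).+1 => // j; case: eqP => [->//|_].
  apply: le_trans (ltW (truncnS_gt M)); apply: le_trans (ler_norm _) _.
  by rewrite /M (bigD1 j)//= lerDl sumr_ge0.
elim/big_ind: _ => [//|A1 A2 h1 h2 C [/h1|/h2]//|i _ _ [C mC <-]].
exact: (mt i measurableT C mC).
Qed.

Lemma cramer_wold_tuple (P1 P2 : probability (n.-tuple R) R) :
  (forall a, forall B, measurable B ->
    P1 (lin_fun a @^-1` B) = P2 (lin_fun a @^-1` B)) ->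
  forall B, measurable B -> P1 B = P2 B.
Proof.
move=> law.
apply: (measure_unique boxes (fun k : nat => [set t | forall i, tnth t i <= k%:R])).
- exact: boxes_measurable.
- move=> _ _ [b ->] [c ->]; exists (fun i => Num.min (b i) (c i)).
  apply/seteqP; split => [t [h1 h2] i|t h]; first by rewrite /= le_min h1 h2.
  by split => i; move: (h i); rewrite le_min => /andP[].
- by move=> k; exists (fun=> k%:R).
- apply/seteqP; split => // t _; pose M := \sum_j `|tnth t j|.
  exists (Num.trunc M).+1 => // j /=.
  apply: le_trans (ltW (truncnS_gt M)); apply: le_trans (ler_norm _) _.
  by rewrite /M (bigD1 j)//= lerDl sumr_ge0.
- move=> _ [b ->].
  apply: (cramer_wold (X1 := fun i t => tnth t i) (X2 := fun i t => tnth t i)).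
  + by move=> i; exact: measurable_tnth.
  + by move=> i; exact: measurable_tnth.
  + move=> a B mB; have := law [tuple a i | i < n] B mB.
    rewrite (_ : lin_fun _ = fun t => \sum_i a i * tnth t i)//.
    by apply/funext => t; apply: eq_bigr => i _; rewrite tnth_mktuple.
- move=> k; apply: le_lt_trans (probability_le1 _ _) (ltry _).
  by rewrite boxes_measurable; apply: sub_sigma_algebra; exists (fun=> k%:R).
Qed.

End cramer_wold_tuple.

Lemma measurable_mktuple (R : realType) n d (T : measurableType d) (X : 'I_n -> T -> R) :
  (forall i, measurable_fun setT (X i)) -> measurable_fun setT (fun t => [tuple X i t | i < n]).
Proof.
move=> mX; apply/measurable_fun_tnthP => i.
by rewrite (_ : _ \o _ = X i)//; apply/funext => t /=; rewrite tnth_mktuple.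
Qed.

Lemma cramer_wold_law (R : realType) n d1 (T1 : measurableType d1) d2 (T2 : measurableType d2)
    (P1 : probability T1 R) (P2 : probability T2 R)
    (X1 : 'I_n -> T1 -> R) (X2 : 'I_n -> T2 -> R) :
  (forall i, measurable_fun setT (X1 i)) -> (forall i, measurable_fun setT (X2 i)) ->
  (forall a : 'I_n -> R, forall B, measurable B ->
    P1 ((fun t => \sum_i a i * X1 i t) @^-1` B) =
    P2 ((fun t => \sum_i a i * X2 i t) @^-1` B)) ->
  forall B : set (n.-tuple R), measurable B ->
    P1 ((fun t => [tuple X1 i t | i < n]) @^-1` B) =
    P2 ((fun t => [tuple X2 i t | i < n]) @^-1` B).
Proof.
move=> mX1 mX2 law.
have [m1 m2] := (measurable_mktuple mX1, measurable_mktuple mX2).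
pose Y1 : {mfun T1 >-> n.-tuple R} := HB.pack (fun t => [tuple X1 i t | i < n])
  (isMeasurableFun.Build _ _ _ _ _ m1).
pose Y2 : {mfun T2 >-> n.-tuple R} := HB.pack (fun t => [tuple X2 i t | i < n])
  (isMeasurableFun.Build _ _ _ _ _ m2).
apply: (cramer_wold_tuple (P1 := distribution P1 Y1) (P2 := distribution P2 Y2)) => a B mB.
have linE T (X : 'I_n -> T -> R) : lin_fun a \o (fun t => [tuple X i t | i < n]) =
    fun t => \sum_i tnth a i * X i t.
  by apply/funext => t; apply: eq_bigr => i _; rewrite tnth_mktuple.
have := law (tnth a) B mB; rewrite -(linE _ X1) -(linE _ X2) => e.
exact: e.
Qed.

(** * One-dimensional normal laws *)

Section lebesgue_affine.
Context {R : realType}.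
Local Notation leb := (@lebesgue_measure R).

Lemma measurable_affine (m s : R) : measurable_fun setT (fun x : R => m + s * x).
Proof. by apply: measurable_funD => //; exact: measurable_funM. Qed.

(** The image of [leb] under the affine map, scaled by [|s|], gives each interval []a, b]] its
    length, and Lebesgue measure is unique. For [s < 0] the preimage is closed on the left instead,
    with the same length. *)
Lemma lebesgue_affine (m s : R) (A : set R) : s != 0 -> measurable A ->
  leb A = (`|s|%:E * leb ((fun x => m + s * x)%R @^-1` A))%E.
Proof.
move=> s0 mA.
have maff : measurable_fun [set: measurableTypeR R] (fun x : measurableTypeR R => m + s * x : measurableTypeR R).
  exact: measurable_affine.
pose nu : {measure set (measurableTypeR R) -> \bar R} :=
  mscale (NngNum (normr_ge0 s)) (pushforward leb (fun x : measurableTypeR R => m + s * x : measurableTypeR R)).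
transitivity (nu maff A); last by [].
apply: lebesgue_measure_unique => // _ [[a b] _ <-].
rewrite /nu /= /mscale /= /pushforward.
have [sp|sn] := ltP 0 s.
  rewrite (_ : _ @^-1` _ = `](a - m) / s, (b - m) / s]%classic); last first.
    apply/seteqP; split => x /=; rewrite !in_itv/=.
      by rewrite ltr_pdivrMr// ler_pdivlMr// ltrBlDl lerBrDl mulrC.
    by rewrite ltr_pdivrMr// ler_pdivlMr// ltrBlDl lerBrDl mulrC.
  rewrite !lebesgue_measure_itv/= !lte_fin ltr_pM2r ?invr_gt0// ltrD2r.
  case: ifPn => _; last by rewrite mule0.
  by rewrite -!EFinB -EFinM; congr EFin; rewrite gtr0_norm//; field.
have {s0 sn} sn : s < 0 by rewrite lt_neqAle s0.
rewrite (_ : _ @^-1` _ = `[(b - m) / s, (a - m) / s[%classic); last first.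
  apply/seteqP; split => x /=; rewrite !in_itv/=.
    by rewrite ltr_ndivlMr// ler_ndivrMr// ltrBlDl lerBrDl mulrC => /andP[-> ->].
  by rewrite ltr_ndivlMr// ler_ndivrMr// ltrBlDl lerBrDl mulrC => /andP[-> ->].
rewrite !lebesgue_measure_itv/= !lte_fin ltr_nM2r ?invr_lt0// ltrD2r.
case: ifPn => _; last by rewrite mule0.
by rewrite -!EFinB -EFinM; congr EFin; rewrite ltr0_norm//; field; rewrite lt_eqF.
Qed.

Lemma ge0_integral_affine (m s : R) (f : R -> \bar R) : s != 0 ->
  measurable_fun setT f -> (forall x, 0 <= f x)%E ->
  (\int[leb]_x f x = \int[leb]_x (`|s|%:E * f (m + s * x)%R))%E.
Proof.
move=> s0 mf f0.
have maff : measurable_fun [set: measurableTypeR R] (fun x : measurableTypeR R => m + s * x : measurableTypeR R).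
  exact: measurable_affine.
pose nu : {measure set (measurableTypeR R) -> \bar R} :=
  mscale (NngNum (normr_ge0 s)) (pushforward leb (fun x : measurableTypeR R => m + s * x : measurableTypeR R)).
transitivity (\int[nu maff]_x f x)%E.
  by apply: eq_measure_integral => A mA _; exact: lebesgue_affine.
rewrite /nu ge0_integral_mscale// ge0_integral_pushforward//.
rewrite ge0_integralZl//; exact: (measurableT_comp mf maff).
Qed.

End lebesgue_affine.

Lemma probability_preimage_cst d (T : measurableType d) (R : realType) (P : probability T R)
    (f : T -> R) (c : R) (B : set R) :
  (forall t, f t = c) -> P (f @^-1` B) = \d_c B.
Proof.
move=> fc; have -> : f = cst c by exact/funext.
rewrite preimage_cst diracE; case: (c \in B); first exact: probability_setT.
exact: measure0.
Qed.

(** * The standard normal law, its affine images and rotations *)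

Section standard_normal.
Context {R : realType}.
Local Notation leb := (@lebesgue_measure R).
Local Notation N0 := (normal_prob (0 : R) 1).
Implicit Types (m s x z : R).

Local Notation phi := (normal_pdf (0 : R) 1).

Lemma phiE z : phi z = normal_peak 1 * expR (- (z ^+ 2) / 2).
Proof. by rewrite normal_pdfE ?oner_neq0// /normal_fun subr0 expr1n. Qed.

Lemma ge0_integral_N0 (g : R -> \bar R) : measurable_fun setT g -> (forall x, 0 <= g x)%E ->
  (\int[N0]_x g x = \int[leb]_x (g x * (phi x)%:E))%E.
Proof.
apply: (@ge0_integral_density _ (measurableTypeR R) R
  (N0 : {measure set (measurableTypeR R) -> \bar R}) leb phi).
split; first exact: measurable_normal_pdf.
by split=> // x; exact: normal_pdf_ge0.
Qed.

(** The substitution [x = m + s z], whose Jacobian cancels the factor [1 / s] in the peak of the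
    density. *)
Lemma normal_probE m s (B : set R) : 0 < s -> measurable B ->
  normal_prob m s B = N0 ((fun z => m + s * z) @^-1` B).
Proof.
move=> s0 mB.
have mB' : measurable ((fun z => m + s * z) @^-1` B).
  by rewrite -[X in measurable X]setTI; exact: measurable_affine.
rewrite /normal_prob [in LHS]integral_mkcond [in RHS]integral_mkcond.
rewrite (ge0_integral_affine m (lt0r_neq0 s0)); last 2 first.
- by apply/(measurable_restrictT _ mB)/measurable_funTS/measurable_EFinP; exact: measurable_normal_pdf.
- by move=> x; rewrite erestrict_ge0// => y _; rewrite lee_fin normal_pdf_ge0.
apply: eq_integral => z _; rewrite !patchE.
have -> : (z \in (fun z => m + s * z) @^-1` B) = (m + s * z \in B) by [].
case: ifP => _; last by rewrite mule0.
rewrite -EFinM; congr EFin; rewrite phiE normal_pdfE ?gt_eqF//.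
rewrite mulrA; congr (_ * _).
  rewrite /normal_peak expr1n mul1r -mulrnAr sqrtrM ?sqr_ge0// sqrtr_sqr (gtr0_norm s0) invfM.
  by rewrite mulrA mulfV ?mul1r// gt_eqF.
rewrite /normal_fun; congr expR; rewrite addrC addKr exprMn.
by field; rewrite gt_eqF.
Qed.

Lemma dirac_N0 m (B : set R) : \d_m B = N0 ((fun z => m + 0 * z) @^-1` B).
Proof.
by rewrite (@probability_preimage_cst _ _ _ N0 _ m)// => z; rewrite mul0r addr0.
Qed.

Lemma N0_opp (B : set R) : measurable B -> N0 ((fun z => - z) @^-1` B) = N0 B.
Proof.
move=> mB.
have mB' : measurable ((fun z => - z) @^-1` B).
  by rewrite -[X in measurable X]setTI; apply: measurable_funN => //.
rewrite /normal_prob [in RHS]integral_mkcond [in LHS]integral_mkcond.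
rewrite [RHS](ge0_integral_affine 0 (_ : -1 != 0)); last 3 first.
- by rewrite oppr_eq0 oner_eq0.
- by apply/(measurable_restrictT _ mB)/measurable_funTS/measurable_EFinP; exact: measurable_normal_pdf.
- by move=> x; rewrite erestrict_ge0// => y _; rewrite lee_fin normal_pdf_ge0.
apply: eq_integral => z _; rewrite add0r mulN1r normrN1 mul1e !patchE.
have -> : (z \in (fun z => - z) @^-1` B) = (- z \in B) by [].
by case: ifP => // _; rewrite !phiE sqrrN.
Qed.

(* Completing the square: [x ^+ 2 + ((u - a * x) / b) ^+ 2 = u ^+ 2 + ((x - a * u) / b) ^+ 2]. *)
Lemma phi_rotation (a b x u : R) : b != 0 -> a ^+ 2 + b ^+ 2 = 1 ->
  phi x * phi ((u - a * x) / b) = phi u * phi ((x - a * u) / b).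
Proof.
move=> b0 ab; rewrite !phiE [LHS]mulrACA [RHS]mulrACA; congr (_ * _).
rewrite -!expRD; congr expR.
have key : (u - a * x) ^+ 2 = (x - a * u) ^+ 2 + (u ^+ 2 - x ^+ 2) * b ^+ 2.
  have -> : b ^+ 2 = 1 - a ^+ 2 by rewrite -ab addrC addKr.
  ring.
by rewrite !expr_div_n key; field.
Qed.

Lemma measurable_phi : measurable_fun setT phi.
Proof. exact: measurable_normal_pdf. Qed.

Lemma integral_phi_affine m s : s != 0 ->
  (\int[leb]_x (phi ((x - m) / s) / `|s|)%:E = 1)%E.
Proof.
move=> s0; rewrite (ge0_integral_affine m s0)/=; last 2 first.
- apply/measurable_EFinP; apply: measurable_funM => //.
  apply: (measurableT_comp measurable_phi).
  by apply: measurable_funM => //; exact: measurable_funB.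
- by move=> x; rewrite lee_fin divr_ge0 ?normal_pdf_ge0.
rewrite -[RHS](integral_normal_pdf 0 1); apply: eq_integral => z _.
rewrite -EFinM; congr EFin; rewrite addrAC subrr add0r mulrC divfK ?normr_eq0//.
by rewrite mulrAC divff ?mul1r.
Qed.

Local Notation N2 := (N0 \x N0)%E.

(** Substituting [u = a x + b y] in the inner integral gives the joint density
    [phi x * phi ((u - a x) / b) / |b|] of [(x, u)]. [phi_rotation] rewrites it with [x] and [u]
    exchanged, Tonelli swaps the integrals, and the one in [x] is then 1. *)
Lemma N0_rotation (a b : R) (B : set R) : a ^+ 2 + b ^+ 2 = 1 -> measurable B ->
  (N2 ((fun z : R * R => a * z.1 + b * z.2)%R @^-1` B) = N0 B)%E.
Proof.
move=> ab mB.
have mlin : measurable_fun [set: R * R] (fun z : R * R => a * z.1 + b * z.2).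
  by apply: measurable_funD; apply: measurable_funM.
have mB' : measurable ((fun z : R * R => a * z.1 + b * z.2) @^-1` B).
  by rewrite -[X in measurable X]setTI; exact: mlin.
have m1B : measurable_fun setT (fun x : R => (\1_B x : R)%:E).
  by apply/measurable_EFinP; exact: measurable_indic.
have Bge0 x : (0 <= (\1_B x : R)%:E)%E by rewrite lee_fin.
(* The substitution divides by [b]; when [b = 0], [a] is 1 or -1 and the symmetry of [N0]
   suffices. *)
have [b0|b0] := eqVneq b 0.
  have mf : measurable_fun [set: R * R] (fun z : R * R => a * z.1) by exact: measurable_funM.
  rewrite -[X in N2 X]setIT -integral_indic// fubini_tonelli1//=; last first.
    by apply/measurable_EFinP; exact: measurable_indic.
  transitivity (\int[N0]_x (\1_((fun x => (a * x)%R) @^-1` B) x)%:E)%E.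
    apply: eq_integral => x _; rewrite /fubini_F /=.
    rewrite (_ : (fun y => _) = cst (\1_((fun x => a * x) @^-1` B) x : R)%:E).
      by rewrite (@integral_cst_prob _ _ _ N0).
    by apply/funext => y; rewrite !indicE; congr ((nat_of_bool _)%:R%:E);
      apply/idP/idP; rewrite !inE/= b0 mul0r addr0.
  have maB : measurable ((fun x => a * x) @^-1` B).
    by rewrite -[X in measurable X]setTI; exact: measurable_funM.
  rewrite integral_indic// setIT.
  have /eqP : a ^+ 2 = 1 by rewrite -ab b0 expr0n addr0.
  rewrite sqrf_eq1 => /orP[] /eqP ->.
    by congr (N0 _); apply/seteqP; split => x /=; rewrite mul1r.
  rewrite -(N0_opp mB); congr (N0 _); apply/seteqP; split => x /=; rewrite mulN1r//.
rewrite -[X in N2 X]setIT -integral_indic//.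
have mi : measurable_fun setT (fun z : R * R => (\1_((fun z : R * R => a * z.1 + b * z.2) @^-1` B) z : R)%:E).
  by apply/measurable_EFinP; exact: measurable_indic.
have mquot : measurable_fun [set: R * R] (fun z : R * R => (z.2 - a * z.1) / b).
  apply: measurable_funM => //; apply: measurable_funB => //; exact: measurable_funM.
pose F (z : R * R) : \bar R := ((\1_B z.2 : R) * (phi z.1 * phi ((z.2 - a * z.1) / b) / `|b|))%:E.
have mF : measurable_fun setT F.
  apply/measurable_EFinP; apply: measurable_funM.
    by apply: measurableT_comp => //; exact: measurable_indic.
  apply: measurable_funM => //; apply: measurable_funM.
    exact: (measurableT_comp measurable_phi).
  exact: (measurableT_comp measurable_phi).
have F0 w : (0 <= F w)%E by rewrite lee_fin !mulr_ge0 ?normal_pdf_ge0 ?invr_ge0.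
rewrite fubini_tonelli1//.
transitivity (\int[leb]_x \int[leb]_u F (x, u))%E.
  rewrite ge0_integral_N0; last 2 first.
  - by apply: measurable_fun_fubini_tonelli_F => // x; rewrite lee_fin.
  - by move=> x; apply: integral_ge0 => y _; rewrite lee_fin.
  apply: eq_integral => x _.
  rewrite /fubini_F ge0_integral_N0; last 2 first.
  - exact: measurable_fun_pair2 mi.
  - by move=> y; rewrite lee_fin.
  rewrite [RHS](ge0_integral_affine (a * x) b0); last 2 first.
  - exact: measurable_fun_pair2 mF.
  - by move=> y; exact: F0.
  rewrite -ge0_integralZr//; last 3 first.
  - apply: emeasurable_funM; first exact: measurable_fun_pair2 mi.
    by apply/measurable_EFinP; exact: measurable_phi.
  - by move=> y _; rewrite mule_ge0// lee_fin ?normal_pdf_ge0.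
  - by rewrite lee_fin normal_pdf_ge0.
  apply: eq_integral => y _; rewrite -!EFinM; congr EFin => /=.
  have -> : (a * x + b * y - a * x) / b = y by rewrite addrAC subrr add0r mulrAC divff ?mul1r.
  have -> : \1_((fun z : R * R => a * z.1 + b * z.2) @^-1` B) (x, y) = \1_B (a * x + b * y) :> R by [].
  by field; rewrite normr_eq0.
rewrite fubini_tonelli//.
rewrite -[in RHS](setIT B) -integral_indic// ge0_integral_N0//.
apply: eq_integral => u _.
transitivity (\int[leb]_x (((\1_B u : R) * phi u)%:E * (phi ((x - a * u) / b) / `|b|)%:E))%E.
  apply: eq_integral => x _; rewrite /F /= phi_rotation// -EFinM; congr EFin.
  by rewrite !mulrA.
rewrite ge0_integralZl//; last 3 first.
- apply/measurable_EFinP; apply: measurable_funM => //; apply: (measurableT_comp measurable_phi).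
  by apply: measurable_funM => //; exact: measurable_funB.
- by move=> x _; rewrite lee_fin divr_ge0 ?normal_pdf_ge0.
- by rewrite lee_fin mulr_ge0 ?normal_pdf_ge0.
by rewrite integral_phi_affine// mule1 EFinM.
Qed.

End standard_normal.

Section normal_laws.
Context {R : realType}.
Local Notation leb := (@lebesgue_measure R).
Local Notation N0 := (normal_prob (0 : R) 1).
Local Notation N2 := (N0 \x N0)%E.
Local Notation phi := (normal_pdf (0 : R) 1).

(** Dividing [(a, b)] by its norm gives a unit vector and reduces to [N0_rotation]; for the zero
    vector both variables are constant. *)
Lemma N0_sum (c a b : R) (B : set R) : measurable B ->
  N2 ((fun z : R * R => c + a * z.1 + b * z.2) @^-1` B) =
  N0 ((fun x => c + Num.sqrt (a ^+ 2 + b ^+ 2) * x) @^-1` B).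
Proof.
move=> mB; set s := Num.sqrt _.
have s2 : s ^+ 2 = a ^+ 2 + b ^+ 2 by rewrite sqr_sqrtr// addr_ge0 ?sqr_ge0.
have [s0|s0] := eqVneq s 0.
  have /eqP : a ^+ 2 + b ^+ 2 = 0 by rewrite -s2 s0 expr0n.
  rewrite paddr_eq0 ?sqr_ge0// !sqrf_eq0 => /andP[/eqP -> /eqP ->].
  rewrite (@probability_preimage_cst _ _ _ N2 _ c)//; last by move=> z; rewrite !mul0r !addr0.
  rewrite (@probability_preimage_cst _ _ _ N0 _ c)//.
  by move=> x; rewrite s0 mul0r addr0.
have mB' : measurable ((fun x => c + s * x) @^-1` B).
  by rewrite -[X in measurable X]setTI; exact: measurable_affine.
rewrite -(@N0_rotation _ (a / s) (b / s) _ _ mB').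
  congr (N2 _); apply/seteqP; split => x /=; rewrite (_ : c + s * _ = c + a * x.1 + b * x.2)//.
    by field.
  by field.
by rewrite !expr_div_n -mulrDl -s2 divff// expf_neq0.
Qed.

(* The logarithm of the density of [N(m', s'^2)] with respect to [N(m, s^2)]. *)
Definition normal_log_ratio (m s m' s' x : R) : R :=
  ln (s / s') + (x - m) ^+ 2 / (2 * s ^+ 2) - (x - m') ^+ 2 / (2 * s' ^+ 2).

Lemma measurable_normal_log_ratio (m s m' s' : R) :
  measurable_fun setT (normal_log_ratio m s m' s').
Proof.
have mq (c v : R) : measurable_fun setT (fun x : R => (x - c) ^+ 2 / v).
  by apply: measurable_funM => //; apply: measurable_funX; exact: measurable_funB.
by apply: measurable_funB => //; apply: measurable_funD.
Qed.

Lemma measurable_expR_log_ratio (m s m' s' : R) :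
  measurable_fun setT (fun x => (expR (normal_log_ratio m s m' s' x))%:E).
Proof.
by apply/measurable_EFinP; exact: measurableT_comp (measurable_normal_log_ratio _ _ _ _).
Qed.

(** Against [leb], the exponential is exactly the quotient of the two normal densities. Both sides
    are written under [N0], so that the lemma applies to one factor of [N0 \x N0]. *)
Lemma N0_tilt (m s m' s' : R) (g : R -> \bar R) : 0 < s -> 0 < s' ->
  measurable_fun setT g -> (forall x, 0 <= g x)%E ->
  (\int[N0]_z (g (m + s * z)%R * (expR (normal_log_ratio m s m' s' (m + s * z)))%:E) =
   \int[N0]_z g (m' + s' * z)%R)%E.
Proof.
move=> s0 s'0 mg g0.
have mr := measurable_normal_log_ratio m s m' s'.
have maff (c v : R) : measurable_fun setT (fun z : R => g (c + v * z)).
  exact: (measurableT_comp mg (measurable_affine _ _)).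
have mdiv (c v : R) : measurable_fun setT (fun x : R => phi ((x - c) / v)).
  apply: (measurableT_comp measurable_phi).
  by apply: measurable_funM => //; exact: measurable_funB.
have me := measurable_expR_log_ratio m s m' s'.
rewrite ge0_integral_N0; last 2 first.
- by apply: emeasurable_funM => //; exact: (measurableT_comp me (measurable_affine _ _)).
- by move=> z; rewrite mule_ge0// lee_fin expR_ge0.
rewrite ge0_integral_N0//.
transitivity (\int[leb]_x (g x * (expR (normal_log_ratio m s m' s' x) *
    (phi ((x - m) / s) / s))%:E))%E.
  rewrite [RHS](ge0_integral_affine m (lt0r_neq0 s0)); last 2 first.
  - apply: emeasurable_funM => //; apply/measurable_EFinP; apply: measurable_funM.
      exact: measurableT_comp mr.
    exact: measurable_funM.
  - by move=> x; rewrite mule_ge0// lee_fin !mulr_ge0 ?expR_ge0 ?normal_pdf_ge0// invr_ge0 ltW.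
  apply: eq_integral => z _; rewrite [RHS]muleCA -muleA; congr (_ * _)%E.
  rewrite -!EFinM; congr EFin; rewrite gtr0_norm//.
  rewrite (_ : (m + s * z - m) / s = z); first by field; rewrite gt_eqF.
  by field; rewrite gt_eqF.
transitivity (\int[leb]_x (g x * (phi ((x - m') / s') / s')%:E))%E.
  apply: eq_integral => x _; congr (_ * _)%E; congr EFin.
  rewrite !phiE /normal_log_ratio.
  rewrite -[X in expR X * _](addrA _ _ (- _)) expRD lnK ?posrE ?divr_gt0//.
  rewrite (_ : _ * (_ * expR _ / s) = s / s' * normal_peak 1 / s *
    (expR ((x - m) ^+ 2 / (2 * s ^+ 2) - (x - m') ^+ 2 / (2 * s' ^+ 2)) *
     expR (- ((x - m) / s) ^+ 2 / 2))); last by ring.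
  rewrite -expRD (_ : _ + - _ / 2 = - ((x - m') / s') ^+ 2 / 2); last first.
    by field; rewrite !gt_eqF.
  by field; rewrite !gt_eqF.
rewrite [LHS](ge0_integral_affine m' (lt0r_neq0 s'0)); last 2 first.
- apply: emeasurable_funM => //; apply/measurable_EFinP; exact: measurable_funM.
- by move=> x; rewrite mule_ge0// lee_fin !mulr_ge0 ?normal_pdf_ge0// invr_ge0 ltW.
apply: eq_integral => z _; rewrite muleCA; congr (_ * _)%E.
rewrite -!EFinM; congr EFin; rewrite gtr0_norm//.
rewrite (_ : (m' + s' * z - m') / s' = z); first by field; rewrite gt_eqF.
by field; rewrite gt_eqF.
Qed.

(** The density of [N(0, 2)] relative to [N(0, 1)] is [expR (z ^+ 2 / 4) / sqrt 2] and has integral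
    1; it dominates, since [z ^+ 2 <= 4 * expR (z ^+ 2 / 4)]. This is where the constant [C] comes
    from. *)
Lemma integrable_N0_sqr : N0.-integrable setT (fun z => (z ^+ 2)%:E).
Proof.
have mX : measurable_fun setT (fun z : R => z ^+ 2) by exact: measurable_funX.
apply/integrableP; split; first exact/measurable_EFinP.
have s2 : 0 < Num.sqrt 2 :> R by rewrite sqrtr_gt0.
have mexp : measurable_fun setT
    (fun z : R => (expR (normal_log_ratio 0 1 0 (Num.sqrt 2) (0 + 1 * z)))%:E).
  exact: (measurableT_comp (measurable_expR_log_ratio _ _ _ _) (measurable_affine _ _)).
have := @N0_tilt 0 1 0 (Num.sqrt 2) (cst 1%E) ltr01 s2 (measurable_cst _) (fun=> lee01).
rewrite (@integral_cst_prob _ _ _ N0); under eq_integral do rewrite mul1e; move=> I1.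
pose C : R := 4 * Num.sqrt 2.
have C0 : 0 <= C by rewrite mulr_ge0 ?sqrtr_ge0.
apply: (@le_lt_trans _ _ (C%:E * \int[N0]_z
    (expR (normal_log_ratio 0 1 0 (Num.sqrt 2) (0 + 1 * z)))%:E)%E); last first.
  by rewrite I1 mule1 ltry.
rewrite -ge0_integralZl//.
apply: ge0_le_integral => //.
- by apply: measurableT_comp => //; exact/measurable_EFinP.
- exact: measurable_funeM.
- move=> z _; rewrite -EFinM lee_fin ger0_norm ?sqr_ge0// /normal_log_ratio.
  rewrite -addrA expRD lnK ?posrE ?divr_gt0// !subr0 add0r !mul1r sqr_sqrtr// expr1n.
  rewrite (_ : C * _ = 4 * expR (z ^+ 2 / (2 * 1) - z ^+ 2 / (2 * 2))); last first.
    by rewrite /C; field; rewrite gt_eqF.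
  have := expR_ge1Dx (z ^+ 2 / (2 * 1) - z ^+ 2 / (2 * 2)); lra.
Qed.

Lemma integrable_N0_id : N0.-integrable setT (fun z => z%:E).
Proof.
have i1 : N0.-integrable setT (fun z => (1 + z ^+ 2)%:E).
  apply: (integrableD (f := cst 1%E) measurableT _ integrable_N0_sqr).
  exact: (@finite_measure_integrable_cst _ _ _ N0).
apply: le_integrable i1 => //; first exact/measurable_EFinP.
move=> z _; rewrite lee_fin [leRHS]ger0_norm.
  by rewrite ler_norml; apply/andP; split; nra.
by rewrite addr_ge0// sqr_ge0.
Qed.

Lemma integral_N0_id : (\int[N0]_z z%:E = 0)%E.
Proof.
have i1 := @integrable_fin_num _ _ _ N0 _ measurableT _ integrable_N0_id.
have mo : measurable_fun setT (fun z : R => - z) by exact: measurable_funN.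
have E : (\int[N0]_z (- z)%:E = \int[N0]_z z%:E)%E.
  apply: (@eq_law_integral _ _ _ _ _ _ R N0 N0 (fun z : R => - z) id mo (@measurable_id _ _ _)
    (fun B mB => N0_opp mB) (fun z => z%:E)).
  exact/measurable_EFinP.
have : (- (\int[N0]_z z%:E) = \int[N0]_z z%:E)%E.
  rewrite -[RHS]E -[RHS]/(\int[N0]_z (- z%:E))%E integralN//.
  exact: integrable_add_def integrable_N0_id.
move: i1; move: (\int[N0]_z z%:E)%E => [r| |]//= _ [] r0; congr EFin; lra.
Qed.

(* The variance of the standard normal law; its value [1] is not needed. *)
Definition N0_var : R := fine (\int[N0]_z (z ^+ 2)%:E).

Lemma integral_N0_sqr : (\int[N0]_z (z ^+ 2)%:E = N0_var%:E)%E.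
Proof. by rewrite fineK//; exact: integrable_fin_num integrable_N0_sqr. Qed.

(** If the variance vanished, [z ^+ 2] would be 0 almost everywhere and [N0] would be carried by the
    point 0, which is Lebesgue-null and so [N0]-null. *)
Lemma N0_var_gt0 : 0 < N0_var.
Proof.
have ge0 : (0 <= \int[N0]_z (z ^+ 2)%:E)%E by apply: integral_ge0 => z _; rewrite lee_fin sqr_ge0.
rewrite lt_neqAle -lee_fin -integral_N0_sqr ge0 andbT.
apply/negP => /eqP v0; have I0 : (\int[N0]_z (z ^+ 2)%:E = 0)%E by rewrite integral_N0_sqr -v0.
have mX : measurable_fun setT (fun z : R => (z ^+ 2)%:E).
  by apply/measurable_EFinP; exact: measurable_funX.
have Iabs : (\int[N0]_z `|(z ^+ 2)%:E| = 0)%E.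
  by rewrite -I0; apply: eq_integral => z _; rewrite gee0_abs// lee_fin sqr_ge0.
have [/(_ Iabs)[N [mN N00 sN]] _] := @ae_eq_integral_abs _ _ _ N0 _ measurableT _ mX.
have m0 : measurable ([set 0] : set (measurableTypeR R)) := measurable_set1 _.
have h2 : N0 (~` [set 0]) = 0%E.
  apply/eqP; rewrite eq_le measure_ge0 andbT -N00 le_measure ?inE//.
    exact: measurableC.
  move=> z /= z0; apply: sN => /= /(_ Logic.I) [] /eqP.
  by rewrite sqrf_eq0 => /eqP.
have h1 := @probability_setC _ _ _ N0 _ m0.
have E0 : N0 [set 0] = 0%E.
  have /null_content_dominatesP H := @normal_prob_dominates R 0 1.
  by apply: H => //; exact: lebesgue_measure_set1.
have : (1 - 0 = 0 :> \bar R)%E :=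
  etrans (congr1 (fun y => 1 - y)%E (esym E0)) (etrans (esym h1) h2).
by rewrite sube0 => /eqP; rewrite onee_eq0.
Qed.

End normal_laws.

(** * Gaussian laws in finite dimension *)

Section normal_law.
Context {R : realType}.
Local Notation N0 := (normal_prob (0 : R) 1).
Local Notation N2 := (N0 \x N0)%E.

(* [s = 0] is allowed and gives the Dirac law at [m]. *)
Definition normal_law d (T : measurableType d) (P : set T -> \bar R) (X : T -> R) (m s : R) :=
  forall B : set R, measurable B -> P (X @^-1` B) = N0 ((fun z => m + s * z) @^-1` B).

Section moments.
Context d (T : measurableType d) (P : probability T R) (X : T -> R) (m s : R).
Hypotheses (mX : measurable_fun setT X) (XN : normal_law P X m s).

Lemma normal_law_integral (u : R -> \bar R) : measurable_fun setT u ->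
  (\int[P]_t u (X t) = \int[N0]_z u (m + s * z)%R)%E.
Proof. exact: (@eq_law_integral _ _ _ _ _ _ R P N0 X _ mX (measurable_affine m s) XN u). Qed.

Lemma normal_law_integrable_sqr (c : R) : P.-integrable setT (fun t => ((X t - c) ^+ 2)%:E).
Proof.
have mu : measurable_fun setT (fun x : R => (x - c) ^+ 2).
  by apply: measurable_funX; exact: measurable_funB.
apply: (@eq_law_integrable _ _ _ _ _ _ R N0 P _ X (measurable_affine m s) mX _ _ mu).
  by move=> B mB; exact/esym/XN.
rewrite (_ : _ \o _ = (fun z => ((m - c) ^+ 2)%:E + ((2 * (m - c) * s)%:E * z%:E + (s ^+ 2)%:E * (z ^+ 2)%:E)))%E.
  apply: integrableD => //; first exact: (@finite_measure_integrable_cst _ _ _ N0).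
  apply: integrableD => //; apply: integrableZl => //; [exact: integrable_N0_id|exact: integrable_N0_sqr].
by apply/funext => z /=; rewrite -!EFinM -!EFinD; congr EFin; ring.
Qed.

Lemma normal_law_mean : (\int[P]_t (X t)%:E = m%:E)%E.
Proof.
rewrite (normal_law_integral (u := EFin)); last exact/measurable_EFinP.
rewrite (_ : (fun z => _) = (cst m%:E \+ (fun z => s%:E * z%:E)))%E; last first.
  by apply/funext => z /=; rewrite -EFinM -EFinD.
rewrite integralD//; last 2 first.
- exact: (@finite_measure_integrable_cst _ _ _ N0).
- by apply: integrableZl => //; exact: integrable_N0_id.
rewrite (@integral_cst_prob _ _ _ N0) integralZl//; last exact: integrable_N0_id.
by rewrite integral_N0_id mule0 adde0.
Qed.

Lemma normal_law_var : (\int[P]_t ((X t - m) ^+ 2)%:E = (s ^+ 2 * N0_var)%:E)%E.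
Proof.
have mu : measurable_fun setT (fun x : R => (x - m) ^+ 2).
  by apply: measurable_funX; exact: measurable_funB.
rewrite (normal_law_integral (u := fun x => ((x - m) ^+ 2)%:E)); last exact/measurable_EFinP.
under eq_integral do rewrite addrAC subrr add0r exprMn EFinM.
by rewrite integralZl//; [rewrite integral_N0_sqr|exact: integrable_N0_sqr].
Qed.

End moments.

Section tilting.
Context d (T : measurableType d) (Q Q' : probability T R) (X W : T -> R) (m s mw sw m' s' : R).
Hypotheses (mX : measurable_fun setT X) (mW : measurable_fun setT W).
Hypotheses (s0 : 0 < s) (s'0 : 0 < s').
Hypothesis XW : forall a b, normal_law Q (fun t => a * X t + b * W t) (a * m + b * mw)
  (Num.sqrt ((a * s) ^+ 2 + (b * sw) ^+ 2)).
Hypothesis dens : is_density Q' Q (fun t => expR (normal_log_ratio m s m' s' (X t))).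

(* Under [Q], [X] and [W] are independent. *)
Let joint (F : 2.-tuple R -> \bar R) : measurable_fun setT F ->
  (\int[Q]_t F [tuple X t; W t] =
   \int[N2]_z F [tuple (m + s * z.1)%R; (mw + sw * z.2)%R])%E.
Proof.
pose X1 (i : 'I_2) : T -> R := if i == 0%N :> nat then X else W.
pose X2 (i : 'I_2) : R * R -> R := fun z => if i == 0%N :> nat then m + s * z.1 else mw + sw * z.2.
have mX1 i : measurable_fun setT (X1 i) by rewrite /X1; case: ifP.
have mX2 i : measurable_fun setT (X2 i).
  rewrite /X2; case: (i == 0%N :> nat).
  - by apply: measurable_funD => //; exact: measurable_funM.
  - by apply: measurable_funD => //; exact: measurable_funM.
have E1 t : [tuple X t; W t] = [tuple X1 i t | i < 2].
  by apply: eq_from_tnth => -[[|[|k]] hk] //; rewrite tnth_mktuple (tnth_nth 0).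
have E2 z : [tuple m + s * z.1; mw + sw * z.2] = [tuple X2 i z | i < 2].
  by apply: eq_from_tnth => -[[|[|k]] hk] //; rewrite tnth_mktuple (tnth_nth 0).
move=> mF; under eq_integral do rewrite E1; under [RHS]eq_integral do rewrite E2.
refine (@eq_law_integral _ _ _ _ _ _ R Q N2 _ _ (measurable_mktuple mX1) (measurable_mktuple mX2) _ F mF).
apply: (@cramer_wold_law _ _ _ _ _ _ Q N2) => // a B mB.
pose a0 := a ord0; pose a1 := a (lift ord0 ord0).
rewrite (_ : (fun t => _) = fun t => a0 * X t + a1 * W t); last first.
  by apply/funext => t; rewrite !big_ord_recl big_ord0 addr0.
rewrite (_ : (fun z => _) = fun z => (a0 * m + a1 * mw) + (a0 * s) * z.1 + (a1 * sw) * z.2); last first.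
  apply/funext => z; rewrite !big_ord_recl big_ord0 addr0 /X2 /= -/a0 -/a1; ring.
exact: etrans (XW _ _ mB) (esym (N0_sum _ _ _ mB)).
Qed.

(** The density depends on [X] only. By independence and Fubini, [N0_tilt] acts on the first
    coordinate with the second one fixed: [X] becomes [N(m', s'^2)], [W] keeps its law, and
    independence persists. *)
Lemma normal_law_tilt (c : R) :
  normal_law Q' (fun t => c * X t + W t) (c * m' + mw) (Num.sqrt ((c * s') ^+ 2 + sw ^+ 2)).
Proof.
move=> B mB.
pose h := normal_log_ratio m s m' s'.
have meh : measurable_fun setT (fun x => (expR (h x))%:E) := measurable_expR_log_ratio _ _ _ _.
have mcXW : measurable_fun setT (fun t => c * X t + W t).
  by apply: measurable_funD => //; exact: measurable_funM.
have mB' : measurable ((fun t => c * X t + W t) @^-1` B).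
  by rewrite -[X in measurable X]setTI; exact: mcXW.
pose g x := (\1_B x : R)%:E.
have mg : measurable_fun setT g by apply/measurable_EFinP; exact: measurable_indic.
have g0 x : (0 <= g x)%E by rewrite lee_fin.
pose F (t : 2.-tuple R) := (g (c * tnth t ord0 + tnth t (lift ord0 ord0))%R * (expR (h (tnth t ord0)))%:E)%E.
have mF : measurable_fun setT F.
  apply: emeasurable_funM; last exact: (measurableT_comp meh (measurable_tnth _)).
  apply: (measurableT_comp mg); apply: measurable_funD; last exact: measurable_tnth.
  by apply: measurable_funM => //; exact: measurable_tnth.
rewrite -[X in Q' X]setIT -integral_indic//.
rewrite (ge0_integral_density dens)//; last by apply/measurable_EFinP; exact: measurable_indic.
transitivity (\int[Q]_t F [tuple X t; W t])%E; first by [].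
rewrite joint//.
pose G (z : R * R) := (g (c * (m + s * z.1) + (mw + sw * z.2))%R * (expR (h (m + s * z.1)))%:E)%E.
pose G' (z : R * R) := g (c * (m' + s' * z.1) + (mw + sw * z.2))%R.
have maff1 (x y : R) : measurable_fun setT (fun z : R * R => x + y * z.1).
  by apply: measurable_funD => //; exact: measurable_funM.
have maff2 (x y : R) : measurable_fun setT (fun z : R * R => x + y * z.2).
  by apply: measurable_funD => //; exact: measurable_funM.
have mG : measurable_fun setT G.
  apply: emeasurable_funM; last exact: (measurableT_comp meh (maff1 _ _)).
  by apply: (measurableT_comp mg); apply: measurable_funD => //; exact: measurable_funM.
have mG' : measurable_fun setT G'.
  by apply: (measurableT_comp mg); apply: measurable_funD => //; exact: measurable_funM.
have G0 w : (0 <= G w)%E by rewrite mule_ge0// lee_fin expR_ge0.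
transitivity (\int[N2]_z G z)%E; first by [].
rewrite fubini_tonelli2//.
transitivity (\int[N2]_z G' z)%E.
  rewrite fubini_tonelli2//; last by move=> w; exact: g0.
  apply: eq_integral => y _.
  apply: (@N0_tilt _ m s m' s' (fun x => g (c * x + (mw + sw * y)))) => //.
  apply: (measurableT_comp mg); apply: measurable_funD => //; exact: measurable_funM.
rewrite -(N0_sum _ _ _ mB).
have mB2 : measurable ((fun z : R * R => c * m' + mw + c * s' * z.1 + sw * z.2) @^-1` B).
  rewrite -[X in measurable X]setTI.
  have : measurable_fun setT (fun z : R * R => c * m' + mw + c * s' * z.1 + sw * z.2).
    by apply: measurable_funD => //; exact: measurable_funM.
  exact.
rewrite -[X in N2 X]setIT -integral_indic//; apply: eq_integral => z _.
rewrite /G' /g !indicE; congr ((nat_of_bool _)%:R%:E).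
have e : c * (m' + s' * z.1) + (mw + sw * z.2) = c * m' + mw + c * s' * z.1 + sw * z.2 by ring.
by apply/idP/idP; rewrite !inE /= e.
Qed.

End tilting.

End normal_law.

(** * Quadratic polynomials and their integrals *)

Section quadratic.
Context {R : realType} (n : nat).
Implicit Types (q : n.-tuple R -> R) (P : probability (n.-tuple R) R).

(** Generated inductively instead of by coefficients, so that measurability, integrability and
    equality of integrals can each be proved by induction on the generators. *)
Inductive quadratic : (n.-tuple R -> R) -> Prop :=
| quadratic_cst c : quadratic (fun=> c)
| quadratic_coord i : quadratic (fun t => tnth t i)
| quadratic_mul i j : quadratic (fun t => tnth t i * tnth t j)
| quadraticD q1 q2 : quadratic q1 -> quadratic q2 -> quadratic (fun t => q1 t + q2 t)
| quadraticZ c q : quadratic q -> quadratic (fun t => c * q t).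

Definition lin (a : 'rV[R]_n) (t : n.-tuple R) : R := \sum_i a 0 i * tnth t i.

Lemma lin_funE (a : n.-tuple R) : lin_fun a = lin (\row_i tnth a i).
Proof. by apply/funext => t; apply: eq_bigr => i _; rewrite mxE. Qed.

Lemma measurable_lin a : measurable_fun setT (lin a).
Proof.
by apply: measurable_sum => i; apply: measurable_funM => //; exact: measurable_tnth.
Qed.

Lemma linD a b t : lin (a + b) t = lin a t + lin b t.
Proof. by rewrite -big_split; apply: eq_bigr => i _; rewrite mxE mulrDl. Qed.

Lemma linZ k a t : lin (k *: a) t = k * lin a t.
Proof. by rewrite mulr_sumr; apply: eq_bigr => i _; rewrite mxE mulrA. Qed.

Lemma quadraticN q : quadratic q -> quadratic (fun t => - q t).
Proof. by move=> qq; under eq_fun do rewrite -mulN1r; exact: quadraticZ. Qed.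

Lemma quadraticB q1 q2 : quadratic q1 -> quadratic q2 -> quadratic (fun t => q1 t - q2 t).
Proof. by move=> h1 h2; apply: quadraticD => //; exact: quadraticN. Qed.

Lemma quadratic_sum (J : Type) (r : seq J) (F : J -> n.-tuple R -> R) :
  (forall j, quadratic (F j)) -> quadratic (fun t => \sum_(j <- r) F j t).
Proof.
move=> qF; elim: r => [|j r ih].
  by under eq_fun do rewrite big_nil; exact: quadratic_cst.
by under eq_fun do rewrite big_cons; exact: quadraticD.
Qed.

Lemma quadratic_lin a : quadratic (lin a).
Proof. by apply: quadratic_sum => i; apply: quadraticZ; exact: quadratic_coord. Qed.

Lemma quadratic_lin_sqr a c : quadratic (fun t => (lin a t - c) ^+ 2).
Proof.
rewrite (_ : (fun t => _) = fun t => (\sum_i \sum_j (a 0 i * a 0 j) * (tnth t i * tnth t j))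
    + ((- 2 * c) * lin a t + c ^+ 2)).
  apply: quadraticD.
    by do 2 apply: quadratic_sum => ?; apply: quadraticZ; exact: quadratic_mul.
  by apply: quadraticD; [apply: quadraticZ; exact: quadratic_lin|exact: quadratic_cst].
apply/funext => t.
have -> : \sum_i \sum_j (a 0 i * a 0 j) * (tnth t i * tnth t j) = lin a t ^+ 2.
  rewrite expr2 /lin mulr_suml; apply: eq_bigr => i _; rewrite mulr_sumr.
  by apply: eq_bigr => j _; rewrite mulrACA.
ring.
Qed.

Lemma quadratic_log_ratio a (m s m' s' : R) :
  quadratic (fun t => normal_log_ratio m s m' s' (lin a t)).
Proof.
apply: quadraticB; first apply: quadraticD; first exact: quadratic_cst.
- by under eq_fun do rewrite mulrC; apply: quadraticZ; exact: quadratic_lin_sqr.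
- by under eq_fun do rewrite mulrC; apply: quadraticZ; exact: quadratic_lin_sqr.
Qed.

Lemma measurable_quadratic q : quadratic q -> measurable_fun setT q.
Proof.
elim=> [c|i|i j|q1 q2 _ m1 _ m2|c q' _ m].
- exact: measurable_cst.
- exact: measurable_tnth.
- by apply: measurable_funM; exact: measurable_tnth.
- exact: measurable_funD.
- exact: measurable_funM.
Qed.

Definition finite_second_moments P :=
  forall i, P.-integrable setT (fun t : n.-tuple R => ((tnth t i) ^+ 2)%:E).

Lemma integrable_coord_mul P i j : finite_second_moments P ->
  P.-integrable setT (fun t : n.-tuple R => (tnth t i * tnth t j)%:E).
Proof.
move=> fP; apply: le_integrable (integrableD measurableT (fP i) (fP j)) => //.
  by apply/measurable_EFinP; apply: measurable_funM; exact: measurable_tnth.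
move=> t _ /=; rewrite lee_fin [leRHS]ger0_norm ?addr_ge0 ?sqr_ge0//.
by rewrite ler_norml; apply/andP; split; nra.
Qed.

Lemma integrable_coord P i : finite_second_moments P ->
  P.-integrable setT (fun t : n.-tuple R => (tnth t i)%:E).
Proof.
move=> fP.
have i1 := integrableD measurableT (finite_measure_integrable_cst P 1 measurableT) (fP i).
apply: le_integrable i1 => //; first by apply/measurable_EFinP; exact: measurable_tnth.
move=> t _ /=; rewrite lee_fin [leRHS]ger0_norm ?addr_ge0 ?sqr_ge0//.
by rewrite ler_norml; apply/andP; split; nra.
Qed.

Lemma integrable_quadratic P q : finite_second_moments P -> quadratic q ->
  P.-integrable setT (EFin \o q).
Proof.
move=> fP; elim=> [c|i|i j|q1 q2 _ m1 _ m2|c q' _ m].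
- exact: (finite_measure_integrable_cst P c measurableT).
- exact: integrable_coord.
- exact: integrable_coord_mul.
- exact: (integrableD measurableT m1 m2).
- exact: (integrableZl measurableT c m).
Qed.

(** [fd_mean] and [fd_cov] are read through [fine]; finite second moments make the underlying
    integrals finite, so the mixed moment is recovered as covariance plus product of means. The
    other cases are linearity. *)
Lemma integral_quadratic P1 P2 q :
  finite_second_moments P1 -> finite_second_moments P2 ->
  (forall i, fd_mean P1 i = fd_mean P2 i) ->
  (forall i j, fd_cov P1 i j = fd_cov P2 i j) ->
  quadratic q -> (\int[P1]_t (q t)%:E = \int[P2]_t (q t)%:E)%E.
Proof.
move=> f1 f2 mE cE.
have meanE P i : finite_second_moments P ->
    (\int[P]_t (tnth t i)%:E = (fd_mean P i)%:E)%E.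
  by move=> fP; rewrite fineK//; apply: integrable_fin_num => //; exact: integrable_coord.
have mulE P i j : finite_second_moments P ->
    (\int[P]_t (tnth t i * tnth t j)%:E = (fd_cov P i j + fd_mean P i * fd_mean P j)%:E)%E.
  move=> fP; have ii := integrable_coord_mul i j fP.
  have [ic jc] := (integrable_coord i fP, integrable_coord j fP).
  rewrite /fd_cov [in RHS](eq_integral (fun t : n.-tuple R => (tnth t i * tnth t j)%:E +
    ((- fd_mean P j)%:E * (tnth t i)%:E + ((- fd_mean P i)%:E * (tnth t j)%:E +
    (cst (fd_mean P i * fd_mean P j)%:E) t))))%E; last first.
    by move=> t _; rewrite -!EFinM -!EFinD; congr EFin; rewrite /=; ring.
  have i3 : P.-integrable setT (cst (fd_mean P i * fd_mean P j)%:E).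
    exact: (finite_measure_integrable_cst P _ measurableT).
  have i2 := integrableD measurableT (integrableZl measurableT (- fd_mean P i) jc) i3.
  have i1 := integrableD measurableT (integrableZl measurableT (- fd_mean P j) ic) i2.
  rewrite (integralD measurableT ii i1) (integralD measurableT (integrableZl measurableT _ ic) i2) (integralD measurableT (integrableZl measurableT _ jc) i3).
  rewrite !integralZl// integral_cst_prob !meanE//.
  have : (\int[P]_t (tnth t i * tnth t j)%:E \is a fin_num)%E by exact: integrable_fin_num.
  case: (\int[P]_t _)%E => // r _; rewrite -!EFinM -!EFinD /=; congr EFin; ring.
elim=> [c|i|i j|q1 q2 h1 e1 h2 e2|c q' h e].
- by rewrite !integral_cst_prob.
- by rewrite !meanE// mE.
- by rewrite !mulE// !mE cE.
- have [i11 i12] := (integrable_quadratic f1 h1, integrable_quadratic f1 h2).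
  have [i21 i22] := (integrable_quadratic f2 h1, integrable_quadratic f2 h2).
  by rewrite !integralD_EFin// e1 e2.
- have [i1 i2] := (integrable_quadratic f1 h, integrable_quadratic f2 h).
  under eq_integral do rewrite EFinM; under [RHS]eq_integral do rewrite EFinM.
  by rewrite !integralZl// e.
Qed.

End quadratic.

Section bilinear_form.
Context {R : realType} (n : nat).
Implicit Types (a b c v : 'rV[R]_n) (S : 'M[R]_n).

Definition dotv a b : R := (a *m b^T) 0 0.
Definition bform S a b : R := (a *m S *m b^T) 0 0.

Lemma dotvDl a b c : dotv (a + b) c = dotv a c + dotv b c.
Proof. by rewrite /dotv mulmxDl mxE. Qed.

Lemma dotvZl k a b : dotv (k *: a) b = k * dotv a b.
Proof. by rewrite /dotv -scalemxAl mxE. Qed.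

Lemma dotvC a b : dotv a b = dotv b a.
Proof. by rewrite /dotv -{1}(trmxK a) -trmx_mul mxE. Qed.

Lemma dotvDr a b c : dotv a (b + c) = dotv a b + dotv a c.
Proof. by rewrite !(dotvC a) dotvDl. Qed.

Lemma dotvZr k a b : dotv a (k *: b) = k * dotv a b.
Proof. by rewrite !(dotvC a) dotvZl. Qed.

Lemma bformDl S a b c : bform S (a + b) c = bform S a c + bform S b c.
Proof. by rewrite /bform !mulmxDl mxE. Qed.

Lemma bformZl S k a b : bform S (k *: a) b = k * bform S a b.
Proof. by rewrite /bform -!scalemxAl mxE. Qed.

Lemma bformDr S a b c : bform S a (b + c) = bform S a b + bform S a c.
Proof. by rewrite /bform raddfD /= mulmxDr mxE. Qed.

Lemma bformZr S k a b : bform S a (k *: b) = k * bform S a b.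
Proof. by rewrite /bform linearZ /= -scalemxAr mxE. Qed.

Lemma bformC S a b : S^T = S -> bform S a b = bform S b a.
Proof.
by move=> ST; rewrite /bform -{1}ST -{1}(trmxK a) -!trmx_mul mxE mulmxA.
Qed.

Lemma bform_rank1 S l v a : bform (S + l *: (v^T *m v)) a a = bform S a a + l * dotv a v ^+ 2.
Proof.
rewrite /bform mulmxDr mulmxDl mxE; congr (_ + _).
rewrite -scalemxAr -scalemxAl mxE; congr (_ * _).
have -> : a *m (v^T *m v) *m a^T = (a *m v^T) *m (v *m a^T) by rewrite !mulmxA.
by rewrite mxE big_ord1 expr2; congr (_ * _); exact: dotvC.
Qed.

Definition posdef S := S^T = S /\ forall a, a != 0 -> 0 < bform S a a.

Lemma posdef_unit S : posdef S -> S \in unitmx.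
Proof.
move=> [_ Sp]; rewrite -row_free_unit -kermx_eq0; apply/rowV0P => a /sub_kermxP aS.
apply/eqP; apply: contraT => /Sp.
by rewrite /bform aS mul0mx mxE ltxx.
Qed.

Lemma posdef_rank1 S l v : 0 <= l -> posdef S -> posdef (S + l *: (v^T *m v)).
Proof.
move=> l0 [ST Sp]; split.
  by rewrite linearD linearZ /= trmx_mul trmxK ST.
by move=> a a0; rewrite bform_rank1 ltr_wpDr ?Sp// mulr_ge0 ?sqr_ge0.
Qed.

End bilinear_form.

(** * Rank one tilts of Gaussian laws *)

Section gaussian_vector.
Context {R : realType} (n : nat).
Implicit Types (a b v m : 'rV[R]_n) (S : 'M[R]_n) (Q : probability (n.-tuple R) R).

(* [S] is the covariance matrix up to the factor [N0_var]. *)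
Definition gauss_dist Q m S := forall a, normal_law Q (lin a) (dotv a m) (Num.sqrt (bform S a a)).

Lemma gauss_dist_unique Q1 Q2 m S : gauss_dist Q1 m S -> gauss_dist Q2 m S ->
  forall B, measurable B -> Q1 B = Q2 B.
Proof.
move=> g1 g2; apply: cramer_wold_tuple => a B mB; rewrite lin_funE.
exact: etrans (g1 _ _ mB) (esym (g2 _ _ mB)).
Qed.

(** An equivalence relation on laws, which allows two laws to be compared through a chain of
    tilts. *)
Definition exp_quadratic_density Q' Q :=
  exists2 q, quadratic q & is_density Q' Q (fun t => expR (q t)).

Lemma exp_quadratic_refl Q : exp_quadratic_density Q Q.
Proof.
exists (fun=> 0); first exact: quadratic_cst.
by rewrite expR0; exact: is_density_id.
Qed.

Lemma exp_quadratic_sym Q Q' : exp_quadratic_density Q Q' -> exp_quadratic_density Q' Q.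
Proof.
move=> [q qq dq]; exists (fun t => - q t); first exact: quadraticN.
exact: is_density_expR_sym.
Qed.

Lemma exp_quadratic_trans Q1 Q2 Q3 : exp_quadratic_density Q1 Q2 ->
  exp_quadratic_density Q2 Q3 -> exp_quadratic_density Q1 Q3.
Proof.
move=> [q1 h1 d1] [q2 h2 d2]; exists (fun t => q1 t + q2 t); first exact: quadraticD.
rewrite (_ : (fun t => _) = (fun t => expR (q1 t)) \* (fun t => expR (q2 t))).
  exact: is_density_trans d1 d2.
by apply/funext => t /=; rewrite expRD.
Qed.

(* The tilt is by a function of [lin a] with [a *m S = v], so that it moves the mean
   and the covariance only in the direction [v]. *)
Lemma gauss_dist_rank1 Q m S v k l : gauss_dist Q m S -> posdef S -> 0 <= l ->
  exists2 Q', exp_quadratic_density Q' Q & gauss_dist Q' (m + k *: v) (S + l *: (v^T *m v)).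
Proof.
move=> gQ pS l0; have [ST Sp] := pS.
have [->|v0] := eqVneq v 0.
  exists Q; first exact: exp_quadratic_refl.
  by rewrite scaler0 mulmx0 scaler0 !addr0.
pose a := v *m invmx S.
have aS : a *m S = v by rewrite mulmxKV// posdef_unit.
have bfE b : bform S a b = dotv v b by rewrite /bform aS.
have a0 : a != 0 by apply: contraNneq v0 => a0; rewrite -aS a0 mul0mx.
set s2 := bform S a a; have s20 : 0 < s2 by exact: Sp.
pose s := Num.sqrt s2; have s0 : 0 < s by rewrite sqrtr_gt0.
have sE : s ^+ 2 = s2 by rewrite sqr_sqrtr// ltW.
(* As [dotv a v = bform S a a = s2], the target mean and covariance give [lin a] the mean
   [mu + k * s2] and the variance [s2 + l * s2 ^+ 2]. *)
pose s' := Num.sqrt (s2 + l * s2 ^+ 2).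
have ls0 : 0 <= l * s2 ^+ 2 by rewrite mulr_ge0// sqr_ge0.
have s'E : s' ^+ 2 = s2 + l * s2 ^+ 2.
  by rewrite sqr_sqrtr// addr_ge0// ltW.
have s'0 : 0 < s' by rewrite sqrtr_gt0 ltr_wpDr.
pose mu := dotv a m; pose mu' := mu + k * s2.
pose q t := normal_log_ratio mu s mu' s' (lin a t).
have qq : quadratic q by exact: quadratic_log_ratio.
have mq := measurable_quadratic qq.
have meq : measurable_fun setT (fun t => expR (q t)) by exact: measurableT_comp mq.
have mlr := measurable_expR_log_ratio mu s mu' s'.
have q1 : (\int[Q]_t (expR (q t))%:E = 1)%E.
  rewrite (@normal_law_integral _ _ _ Q _ _ _ (measurable_lin a) (gQ a)
    (fun x => (expR (normal_log_ratio mu s mu' s' x))%:E))//.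
  rewrite -[RHS](@integral_cst_prob _ _ R (normal_prob 0 1)).
  rewrite -(@N0_tilt _ mu s mu' s' (cst 1%E))//.
  by apply: eq_integral => z _; rewrite mul1e.
have [Q' dens] := tilt_exists meq (fun t => expR_ge0 _) q1.
exists Q'; first by exists q.
move=> b.
(* [c *: a] is the [S]-orthogonal projection of [b] on [a], so [lin w] is uncorrelated with [lin a]
   under [Q]. *)
pose c := bform S a b / s2; pose w := b - c *: a.
have aw : bform S a w = 0.
  by rewrite /w -scaleNr bformDr bformZr -/s2 mulNr /c divfK ?gt_eqF// subrr.
have ww0 : 0 <= bform S w w.
  have [->|/Sp/ltW//] := eqVneq w 0.
  by rewrite /bform mul0mx mul0mx mxE.
have bE : b = c *: a + w by rewrite /w addrC subrK.
have cE : c * s2 = dotv b v by rewrite /c divfK ?gt_eqF// bfE dotvC.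
clearbody w; clearbody c.
have law x y : normal_law Q (fun t => x * lin a t + y * lin w t) (x * mu + y * dotv w m)
    (Num.sqrt ((x * s) ^+ 2 + (y * Num.sqrt (bform S w w)) ^+ 2)).
  have -> : (fun t => x * lin a t + y * lin w t) = lin (x *: a + y *: w).
    by apply/funext => t; rewrite linD !linZ.
  have -> : x * mu + y * dotv w m = dotv (x *: a + y *: w) m by rewrite dotvDl !dotvZl.
  rewrite !exprMn sE sqr_sqrtr//.
  have -> : x ^+ 2 * s2 + y ^+ 2 * bform S w w = bform S (x *: a + y *: w) (x *: a + y *: w).
    rewrite !(bformDl, bformDr, bformZl, bformZr) (bformC w a ST) aw -/s2; ring.
  exact: gQ.
have := normal_law_tilt (measurable_lin a) (measurable_lin w) s0 s'0 law dens c.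
have -> : (fun t => c * lin a t + lin w t) = lin b.
  by apply/funext => t; rewrite [in RHS]bE linD linZ.
have -> : c * mu' + dotv w m = dotv b (m + k *: v).
  have bm : dotv b m = c * mu + dotv w m by rewrite [in LHS]bE dotvDl dotvZl.
  by rewrite dotvDr dotvZr -cE bm /mu'; ring.
have -> : (c * s') ^+ 2 + Num.sqrt (bform S w w) ^+ 2 = bform (S + l *: (v^T *m v)) b b.
  rewrite bform_rank1 -cE exprMn s'E sqr_sqrtr//.
  have -> : bform S b b = bform S (c *: a + w) (c *: a + w) by rewrite -bE.
  rewrite !(bformDl, bformDr, bformZl, bformZr) (bformC w a ST) aw -/s2; ring.
exact.
Qed.

(** An entry [(k, l, v)] stands for one tilt in direction [v]; [l >= 0] keeps the covariance
    positive definite, so that the next tilt is possible. *)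
Lemma gauss_dist_shift Q m S (r : seq (R * R * 'rV[R]_n)) :
  gauss_dist Q m S -> posdef S -> all (fun x => 0 <= x.1.2) r ->
  exists2 Q', exp_quadratic_density Q' Q & gauss_dist Q' (m + \sum_(x <- r) x.1.1 *: x.2)
    (S + \sum_(x <- r) x.1.2 *: (x.2^T *m x.2)).
Proof.
elim: r Q m S => [|[[k l] v] r ih] Q m S gQ pS /=.
  by move=> _; exists Q; [exact: exp_quadratic_refl|rewrite !big_nil !addr0].
move=> /andP[l0 r0].
have [Q' Q'Q gQ'] := gauss_dist_rank1 v k gQ pS l0.
have [Q'' Q''Q' gQ''] := ih _ _ _ gQ' (posdef_rank1 v l0 pS) r0.
exists Q''; first exact: exp_quadratic_trans Q''Q' Q'Q.
by rewrite !big_cons !addrA.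
Qed.

(* Both laws are tilted to the same Gaussian law: the difference of the covariances is a
   combination of the matrices [v^T *m v] with [v = e_i + e_j] and [v = e_i - e_j]. *)
Lemma gauss_dist_exp_quadratic Q1 Q2 m1 m2 S1 S2 :
  gauss_dist Q1 m1 S1 -> gauss_dist Q2 m2 S2 -> posdef S1 -> posdef S2 ->
  exp_quadratic_density Q1 Q2.
Proof.
move=> g1 g2 p1 p2.
pose e i : 'rV[R]_n := delta_mx 0 i.
pose D := S2 - S1.
have DT : D^T = D by rewrite /D linearB /= (proj1 p1) (proj1 p2).
(* Weights must be nonnegative, so each signed coefficient [x] is split as [mx0 x - mx0 (- x)], one
   part going to either law. *)
pose mx0 (x : R) := Num.max x 0.
have mx0_ge0 x : 0 <= mx0 x by rewrite le_max lexx orbT.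
pose P := [seq (i, j) | i <- enum 'I_n, j <- enum 'I_n].
(* By [pq] below, [D i j / 4] times the difference of the two rank one matrices is half of [D i j]
   times [delta_mx i j + delta_mx j i]; summed over ordered pairs this is the symmetric matrix [D].
   Taking [f] to be the opposite exchanges the two parts. The means are matched separately in [r1],
   by entries of weight 0 along the basis vectors. *)
pose rp (f : R -> R) : seq (R * R * 'rV[R]_n) :=
  [seq (0, mx0 (f (D p.1 p.2 / 4)), e p.1 + e p.2) | p <- P] ++
  [seq (0, mx0 (f (- (D p.1 p.2 / 4))), e p.1 - e p.2) | p <- P].
pose r1 := [seq ((m2 - m1) 0 i, 0, e i) | i <- enum 'I_n] ++ rp id.
pose r2 := rp -%R.
have a1 : all (fun x => 0 <= x.1.2) r1.
  by rewrite !all_cat !all_map; apply/and3P; split; apply/allP => i _ /=.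
have a2 : all (fun x => 0 <= x.1.2) r2.
  by rewrite !all_cat !all_map; apply/andP; split; apply/allP => i _ /=.
have mx0B x : mx0 x - mx0 (- x) = x.
  have [x0|/ltW x0] := leP 0 x.
    have nx0 : - x <= 0 by rewrite oppr_le0.
    by rewrite /mx0 (max_l x0) (max_r nx0) subr0.
  have nx0 : 0 <= - x by rewrite oppr_ge0.
  by rewrite /mx0 (max_r x0) (max_l nx0) sub0r opprK.
have pq i j : (e i + e j)^T *m (e i + e j) - (e i - e j)^T *m (e i - e j) =
    2 *: (delta_mx i j + delta_mx j i).
  rewrite !linearD !linearN /= !trmx_delta !(mulmxDl, mulmxDr, mulNmx, mulmxN) !mul_delta_mx.
  by apply/matrixP => x y; rewrite !mxE; ring.
have [Q1' d1 g1'] := gauss_dist_shift g1 p1 a1.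
have [Q2' d2 g2'] := gauss_dist_shift g2 p2 a2.
have mrp f : \sum_(x <- rp f) x.1.1 *: x.2 = 0.
  by rewrite big_cat !big_map /= !big1 ?addr0// => i _; rewrite scale0r.
have mE : m1 + \sum_(x <- r1) x.1.1 *: x.2 = m2 + \sum_(x <- r2) x.1.1 *: x.2.
  rewrite big_cat mrp /r2 mrp big_map big_enum /= !addr0.
  by rewrite -[X in _ + X](row_sum_delta (m2 - m1)) addrC subrK.
have SE : S1 + \sum_(x <- r1) x.1.2 *: (x.2^T *m x.2) = S2 + \sum_(x <- r2) x.1.2 *: (x.2^T *m x.2).
  rewrite /r1 big_cat big_map /= big1 ?add0r; last by move=> i _; rewrite scale0r.
  rewrite /r2 /rp !big_cat !big_map /=.
  set X := (X in S1 + X); set Y := (Y in S2 + Y).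
  suff XY : X = D + Y by rewrite XY /D addrA addrC [S1 + _]addrC subrK addrC.
  apply/eqP; rewrite -subr_eq /X /Y opprD addrACA -!sumrB -big_split /=.
  rewrite big_allpairs !big_enum /=.
  under eq_bigr => i _.
    rewrite big_enum /=; under eq_bigr => j _ do rewrite -!scalerBl opprK mx0B -opprB mx0B
      scaleNr -scalerBr pq.
    over.
  rewrite [X in _ == X](matrix_sum_delta D); apply/eqP.
  transitivity (\sum_i \sum_j ((2^-1 * D i j) *: delta_mx i j + (2^-1 * D i j) *: delta_mx j i)).
    apply: eq_bigr => i _; apply: eq_bigr => j _.
    by rewrite -scalerDr scalerA; congr (_ *: _); field.
  under eq_bigr do rewrite big_split; rewrite big_split /= [X in _ + X]exchange_big -big_split /=.
  apply: eq_bigr => i _; rewrite -big_split /=; apply: eq_bigr => j _.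
  have -> : D j i = D i j by rewrite -{1}DT mxE.
  rewrite -scalerDl; congr (_ *: _); lra.
move: g1'; rewrite mE SE => g1'.
have QE := gauss_dist_unique g1' g2'.
apply: exp_quadratic_trans (exp_quadratic_sym d1) _.
apply: exp_quadratic_trans d2.
(* The two tilted laws agree on measurable sets only, so the trivial density is carried over by
   hand. *)
have [q qq [mq [q0 Qq]]] := exp_quadratic_refl Q2'.
by exists q => //; split=> //; split=> // A mA; rewrite QE// Qq.
Qed.

End gaussian_vector.

Section moments.
Context {R : realType} (n : nat).
Implicit Types (a : 'rV[R]_n) (P Q : probability (n.-tuple R) R).

Definition mean_vec (P : set (n.-tuple R) -> \bar R) : 'rV[R]_n := \row_i fd_mean P i.
Definition cov_mx (P : set (n.-tuple R) -> \bar R) : 'M[R]_n := \matrix_(i, j) fd_cov P i j.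

Lemma bform_cov P a : bform (cov_mx P) a a = \sum_i \sum_j a 0 i * fd_cov P i j * a 0 j.
Proof.
rewrite /bform mxE exchange_big; apply: eq_bigr => j _; rewrite !mxE mulr_suml.
by apply: eq_bigr => i _; rewrite mxE.
Qed.

Lemma integral_lin P a : finite_second_moments P ->
  (\int[P]_t (lin a t)%:E = (dotv a (mean_vec P))%:E)%E.
Proof.
move=> fP; under eq_integral do rewrite /lin -sumEFin.
rewrite integral_sum//; last first.
  by move=> i; exact: (integrableZl measurableT (a 0 i) (integrable_coord i fP)).
rewrite /dotv mxE -sumEFin; apply: eq_bigr => i _.
rewrite (integralZl measurableT (integrable_coord i fP)) !mxE EFinM fineK//.
by apply: integrable_fin_num => //; exact: integrable_coord.
Qed.

Lemma integral_lin_sqr P a : finite_second_moments P ->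
  (\int[P]_t ((lin a t - dotv a (mean_vec P)) ^+ 2)%:E = (bform (cov_mx P) a a)%:E)%E.
Proof.
move=> fP.
pose c i j t := (tnth t i - fd_mean P i) * (tnth t j - fd_mean P j).
have qc i j : quadratic (c i j).
  rewrite (_ : c i j = fun t => tnth t i * tnth t j + ((- fd_mean P j) * tnth t i +
     ((- fd_mean P i) * tnth t j + fd_mean P i * fd_mean P j))).
    apply: quadraticD; first exact: quadratic_mul.
    apply: quadraticD; first by apply: quadraticZ; exact: quadratic_coord.
    apply: quadraticD; last exact: quadratic_cst.
    by apply: quadraticZ; exact: quadratic_coord.
  by apply/funext => t; rewrite /c; ring.
have ic i j := integrable_quadratic fP (qc i j).
have E t : (lin a t - dotv a (mean_vec P)) ^+ 2 = \sum_i \sum_j (a 0 i * a 0 j) * c i j t.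
  rewrite (_ : _ - _ = \sum_i a 0 i * (tnth t i - fd_mean P i)).
    rewrite expr2 mulr_suml; apply: eq_bigr => i _; rewrite mulr_sumr.
    by apply: eq_bigr => j _; rewrite mulrACA.
  rewrite /lin /dotv mxE -sumrB; apply: eq_bigr => i _; by rewrite !mxE mulrBr.
under eq_integral do rewrite E -sumEFin.
have is_ i j : P.-integrable setT (fun t => (a 0 i * a 0 j * c i j t)%:E).
  exact: (integrableZl measurableT _ (ic i j)).
rewrite integral_sum//; last first.
  move=> i; under eq_fun do rewrite -sumEFin.
  by apply: integrable_sum.
rewrite bform_cov -sumEFin; apply: eq_bigr => i _.
under eq_integral do rewrite -sumEFin.
rewrite integral_sum// -sumEFin; apply: eq_bigr => j _.
rewrite (integralZl measurableT (ic i j)) [in RHS]mulrAC [RHS]EFinM; congr (_ * _)%E.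
by rewrite fineK//; apply: integrable_fin_num => //; exact: ic.
Qed.

Lemma cov_mx_sym P : (cov_mx P)^T = cov_mx P.
Proof.
apply/matrixP => i j; rewrite !mxE /fd_cov; congr fine.
by apply: eq_integral => t _; rewrite mulrC.
Qed.

Lemma posdef_cov P : fd_nondegenerate P -> posdef (cov_mx P).
Proof.
move=> [_ Pp]; split; first exact: cov_mx_sym.
move=> a a0; rewrite bform_cov.
pose v := [tuple a 0 i | i < n].
rewrite (_ : \sum_i _ = \sum_i \sum_j tnth v i * fd_cov P i j * tnth v j); last first.
  by apply: eq_bigr => i _; apply: eq_bigr => j _; rewrite !tnth_mktuple.
by apply: Pp; have /rV0Pn[i ai] := a0; exists i; rewrite tnth_mktuple.
Qed.

End moments.

(** * Divergence from Gaussian laws *)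

Section gaussian.
Context {R : realType} (n : nat).
Implicit Types (a : 'rV[R]_n) (P Q G H : probability (n.-tuple R) R).

Lemma gaussian_normal_law Q a : is_gaussian Q ->
  exists m s, 0 <= s /\ normal_law Q (lin a) m s.
Proof.
move=> /(_ [tuple a 0 i | i < n]); rewrite lin_funE.
rewrite (_ : \row_i _ = a); last by apply/rowP => i; rewrite mxE tnth_mktuple.
move=> [[m [s [s0 h]]]|[m h]].
  by exists m, s; split; [exact: ltW|move=> B mB; rewrite -normal_probE//; exact: h].
by exists m, 0; split=> // B mB; rewrite -dirac_N0; exact: h.
Qed.

Lemma gaussian_second_moments Q : is_gaussian Q -> finite_second_moments Q.
Proof.
move=> gQ i; have [m [s [_ l]]] := gaussian_normal_law (delta_mx 0 i) gQ.
have := normal_law_integrable_sqr (measurable_lin _) l 0.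
rewrite (_ : (fun t => _) = (fun t => (tnth t i ^+ 2)%:E))//.
apply/funext => t; rewrite subr0 /lin (bigD1 i)//= mxE !eqxx mul1r big1 ?addr0//.
by move=> j ji; rewrite mxE (negbTE ji) andbF mul0r.
Qed.

(** [is_gaussian] provides parameters separately for each linear form. The mean identifies [m], and
    the variance, equal to [s ^+ 2 * N0_var], identifies [s]; so they depend on the form through one
    vector and one matrix. *)
Lemma gaussian_gauss_dist Q : is_gaussian Q ->
  gauss_dist Q (mean_vec Q) ((@N0_var R)^-1 *: cov_mx Q).
Proof.
move=> gQ a; have [m [s [s0 l]]] := gaussian_normal_law a gQ.
have fQ := gaussian_second_moments gQ.
have mE : dotv a (mean_vec Q) = m.
  apply: EFin_inj; rewrite -integral_lin//.
  exact: normal_law_mean (measurable_lin a) l.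
have := normal_law_var (measurable_lin a) l.
rewrite -{1}mE integral_lin_sqr// => -[vE].
have -> : bform ((@N0_var R)^-1 *: cov_mx Q) a a = s ^+ 2.
  rewrite /bform -scalemxAr -scalemxAl mxE -/(bform _ a a) vE.
  by rewrite mulrCA mulVf ?mulr1// gt_eqF// N0_var_gt0.
by rewrite sqrtr_sqr ger0_norm// mE.
Qed.

Lemma gaussian_exp_quadratic P Q : is_gaussian P -> is_gaussian Q ->
  fd_nondegenerate P -> fd_nondegenerate Q -> exp_quadratic_density P Q.
Proof.
have v0 : 0 < (@N0_var R)^-1 by rewrite invr_gt0 N0_var_gt0.
have pd (N : probability (n.-tuple R) R) : fd_nondegenerate N -> posdef ((@N0_var R)^-1 *: cov_mx N).
  move=> nN; have [sN pN] := posdef_cov nN; split; first by rewrite linearZ /= sN.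
  move=> a a0; rewrite /bform -scalemxAr -scalemxAl mxE mulr_gt0//.
  exact: pN.
move=> gP gQ /pd pP /pd pQ.
exact: gauss_dist_exp_quadratic (gaussian_gauss_dist gP) (gaussian_gauss_dist gQ) pP pQ.
Qed.

(* A degenerate Gaussian law is carried by a hyperplane, which [P] cannot be. *)
Lemma density_gaussian_nondegenerate P Q f : is_density P Q f -> is_gaussian Q ->
  fd_nondegenerate P -> fd_nondegenerate Q.
Proof.
move=> [mf [f0 Pf]] gQ [fP Pp]; have fQ := gaussian_second_moments gQ.
split=> // v [i vi].
pose a : 'rV[R]_n := \row_i tnth v i.
have sumE (N : probability (n.-tuple R) R) :
    \sum_i \sum_j tnth v i * fd_cov N i j * tnth v j = bform (cov_mx N) a a.
  by rewrite bform_cov; apply: eq_bigr => ? _; apply: eq_bigr => ? _; rewrite !mxE.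
have := Pp v (ex_intro _ i vi); rewrite !sumE => Pa.
have [m [s [s0 l]]] := gaussian_normal_law a gQ.
have mE : dotv a (mean_vec Q) = m.
  apply: EFin_inj; rewrite -integral_lin//.
  exact: normal_law_mean (measurable_lin a) l.
have := normal_law_var (measurable_lin a) l.
rewrite -{1}mE integral_lin_sqr// => -[->].
rewrite mulr_gt0 ?N0_var_gt0// exprn_gt0// lt_neqAle s0 andbT; apply/negP => /eqP s00.
pose N := lin a @^-1` [set~ m].
have mN : measurable N.
  rewrite -[X in measurable X]setTI; apply: measurable_lin => //.
  by apply: measurableC; exact: measurable_set1.
have QN : Q N = 0%E.
  rewrite l; last by apply: measurableC; exact: measurable_set1.
  rewrite (_ : _ @^-1` _ = set0) ?measure0//.
  by apply/seteqP; split=> // z /=; rewrite -s00 mul0r addr0.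
have PN : P N = 0%E.
  rewrite Pf//; apply: null_set_integral => //.
  by apply/measurable_EFinP; exact: measurable_funTS.
have ae (u : R -> R) : measurable_fun setT u ->
    (\int[P]_t (u (lin a t))%:E = (u m)%:E)%E.
  move=> mu; rewrite -[RHS](integral_cst_prob P); apply: ae_eq_integral => //.
    by apply/measurable_EFinP; exact: (measurableT_comp mu (measurable_lin a)).
  exists N; split=> // t /=; apply: contra_not => h _.
  by rewrite /cst; congr (u _)%:E; apply: contrapT.
have mPE : dotv a (mean_vec P) = m.
  by apply: EFin_inj; rewrite -integral_lin// (ae id).
have := integral_lin_sqr a fP; rewrite mPE (ae (fun x => (x - m) ^+ 2)).
  by rewrite subrr expr0n => -[] PE; rewrite -PE ltxx in Pa.
by apply: measurable_funX; exact: measurable_funB.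
Qed.

(* The Pythagorean identity: [ln (dG/dQ)] is quadratic, so that its integrals under [P] and
   under [G] agree. *)
Lemma KL_pythagoras P G Q : finite_second_moments P -> is_gaussian G -> is_gaussian Q ->
  fd_nondegenerate G -> fd_nondegenerate Q ->
  (forall i, fd_mean P i = fd_mean G i) -> (forall i j, fd_cov P i j = fd_cov G i j) ->
  (KL P G < +oo -> KL P Q = KL P G + KL G Q /\ KL G Q \is a fin_num)%E.
Proof.
move=> fP gG gQ nG nQ mE cE PG.
have [q qq dq] := gaussian_exp_quadratic gG gQ nG nQ.
have fG := gaussian_second_moments gG.
have iq := integrable_quadratic fP qq.
rewrite (KL_tilt dq (measurable_quadratic qq) iq PG) (KL_expR dq).
rewrite (integral_quadratic fP fG mE cE qq); split=> //.
by apply: integrable_fin_num => //; exact: integrable_quadratic fG qq.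
Qed.

(** The two divergences differ by the [P]-integral of a quadratic polynomial, finite because [P] has
    second moments. Finiteness thus passes from one Gaussian reference law to any other. *)
Lemma KL_gaussian_lty P H G : finite_second_moments P -> is_gaussian H -> is_gaussian G ->
  fd_nondegenerate H -> fd_nondegenerate G -> (KL P H < +oo -> KL P G < +oo)%E.
Proof.
move=> fP gH gG nH nG PH.
have [q qq dq] := gaussian_exp_quadratic gH gG nH nG.
have iq := integrable_quadratic fP qq.
rewrite (KL_tilt dq (measurable_quadratic qq) iq PH) lte_add_pinfty// ltey_eq.
by rewrite (integrable_fin_num measurableT iq).
Qed.

Lemma gauss_divE P G Q : fd_nondegenerate P -> is_gaussian G -> is_gaussian Q ->
  fd_nondegenerate G -> fd_nondegenerate Q ->
  (forall i, fd_mean P i = fd_mean G i) -> (forall i j, fd_cov P i j = fd_cov G i j) ->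
  (KL P G < +oo -> gauss_div P Q = KL G Q)%E.
Proof.
move=> nP gG gQ nG nQ mE cE PG; have fP := proj1 nP.
have PGfin : KL P G \is a fin_num by rewrite ge0_fin_numE// KL_ge0.
rewrite /gauss_div; set inf := ereal_inf _.
have -> : inf = KL P G.
  apply/eqP; rewrite eq_le; apply/andP; split; first by apply: ereal_inf_lbound; exists G.
  apply/ereal_infP => _ [xi gxi <-].
  (* Only competitors at finite divergence matter; for these the density of [P] forces [xi] to be
     non-degenerate. *)
  have [->|] := eqVneq (KL P xi) +oo%E; first by rewrite leey.
  rewrite -ltey => Pxi.
  have [f [df _]] := KL_ltyP Pxi.
  have nxi := density_gaussian_nondegenerate df gxi nP.
  have [-> _] := KL_pythagoras fP gG gxi nG nxi mE cE PG.
  by rewrite leeDl// KL_ge0.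
rewrite PGfin; have [-> _] := KL_pythagoras fP gG gQ nG nQ mE cE PG.
by rewrite addeAC subee// add0e.
Qed.

End gaussian.

(** * Processes *)

Section process.
Context {R : realType}.
Implicit Types (mu nu xi : probability (cylR R) R).

Lemma measurable_coordinate (x : R) : measurable_fun [set: cylR R] (fun f : cylR R => f x).
Proof.
move=> _ B mB; apply: sub_sigma_algebra; exists x => //; exists B => //.
Qed.

Lemma measurable_evalt n (x : n.-tuple R) : measurable_fun [set: cylR R] (evalt x).
Proof.
apply/measurable_fun_tnthP => i.
rewrite (_ : _ \o _ = fun f : cylR R => f (tnth x i)); first exact: measurable_coordinate.
by apply/funext => f /=; rewrite tnth_map.
Qed.

Definition evalt_mfun n (x : n.-tuple R) : {mfun cylR R >-> n.-tuple R} :=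
  HB.pack (evalt x) (isMeasurableFun.Build _ _ _ _ _ (measurable_evalt x)).

(** [fdd] is a bare set function; this packaging is convertible to it and carries the probability
    structure required by the finite-dimensional lemmas. *)
Definition fdd_prob n (x : n.-tuple R) mu : probability (n.-tuple R) R :=
  distribution mu (evalt_mfun x).

Lemma integral_fdd n (x : n.-tuple R) mu (u : n.-tuple R -> \bar R) :
  measurable_fun setT u -> (\int[fdd x mu]_t u t = \int[mu]_f u (evalt x f))%E.
Proof.
move=> mu'.
exact: (@eq_law_integral _ _ _ _ _ _ R (fdd_prob x mu) mu id _ (@measurable_id _ _ _)
  (measurable_evalt x) (fun B mB => erefl) u mu').
Qed.

Lemma fd_mean_fdd n (x : n.-tuple R) mu i : fd_mean (fdd x mu) i = p_mean mu (tnth x i).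
Proof.
rewrite /fd_mean integral_fdd; last by apply/measurable_EFinP; exact: measurable_tnth.
by congr fine; apply: eq_integral => f _; rewrite tnth_map.
Qed.

Lemma fd_cov_fdd n (x : n.-tuple R) mu i j :
  fd_cov (fdd x mu) i j = p_cov mu (tnth x i) (tnth x j).
Proof.
rewrite /fd_cov integral_fdd; last first.
  by apply/measurable_EFinP; apply: measurable_funM; apply: measurable_funB => //;
    exact: measurable_tnth.
by congr fine; apply: eq_integral => f _; rewrite !fd_mean_fdd !tnth_map.
Qed.

(** The coordinate projection from inputs [z] to inputs [x]. The default 0 is never read when the
    entries of [x] occur in [z]. *)
Definition subtuple k (x : k.-tuple R) n (z : n.-tuple R) (t : n.-tuple R) : k.-tuple R :=
  map_tuple (fun y => nth 0 t (index y z)) x.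

Lemma measurable_subtuple k (x : k.-tuple R) n (z : n.-tuple R) :
  {subset x <= z} -> measurable_fun setT (subtuple x z).
Proof.
move=> xz; apply/measurable_fun_tnthP => i.
have iz : (index (tnth x i) z < n)%N.
  by rewrite -[X in (_ < X)%N](size_tuple z) index_mem xz// mem_tnth.
rewrite (_ : _ \o _ = (@tnth n R ^~ (Ordinal iz))); first exact: measurable_tnth.
by apply/funext => t /=; rewrite tnth_map [RHS](tnth_nth 0).
Qed.

Lemma evalt_subtuple k (x : k.-tuple R) n (z : n.-tuple R) (f : cylR R) :
  {subset x <= z} -> evalt x f = subtuple x z (evalt z f).
Proof.
move=> xz; apply: eq_from_tnth => i; rewrite !tnth_map (nth_map 0) ?nth_index//.
  by rewrite xz// mem_tnth.
by rewrite index_mem xz// mem_tnth.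
Qed.

Lemma KL_fdd_le k (x : k.-tuple R) n (z : n.-tuple R) mu nu : {subset x <= z} ->
  (KL (fdd x mu) (fdd x nu) < +oo ->
   KL (fdd x mu) (fdd x nu) <= KL (fdd z mu) (fdd z nu))%E.
Proof.
move=> xz.
have fE (N : probability (cylR R) R) B : fdd x N B = fdd z N (subtuple x z @^-1` B).
  rewrite /fdd /pushforward (_ : evalt x = subtuple x z \o evalt z)//.
  by apply/funext => f; exact: evalt_subtuple.
exact: (@KL_pushforward _ _ _ _ R (fdd_prob z mu) (fdd_prob z nu) (fdd_prob x mu)
  (fdd_prob x nu) _ (measurable_subtuple xz) (fun B _ => fE mu B) (fun B _ => fE nu B)).
Qed.

Lemma in_I_directed k (x : k.-tuple R) l (y : l.-tuple R) : in_I x -> in_I y ->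
  exists n (z : n.-tuple R), [/\ in_I z, {subset x <= z} & {subset y <= z}].
Proof.
move=> [k0 ux] [l0 uy]; exists (size (undup (x ++ y))), (in_tuple (undup (x ++ y))).
have sx : {subset x <= undup (x ++ y)} by move=> u ux'; rewrite mem_undup mem_cat ux'.
split=> //; last by move=> u uy'; rewrite /= mem_undup mem_cat uy' orbT.
split; last exact: undup_uniq.
have := sx (tnth x (Ordinal k0)) (mem_tnth _ _).
by case: (undup _).
Qed.

End process.

(** For the lower bound, given [x] and [y], an index [z] above both gives
    [B x + C y <= B z + C z = A z], and the suprema over [x] and [y] can be taken separately. Only
    the supremum of [B] is finite by assumption, hence the form as a difference: the other two may
    be infinite. *)
Lemma directed_sup_add (R : realType) (J : Type) (I : set J) (A B C : J -> \bar R) :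
  I !=set0 ->
  (forall x y, I x -> I y -> exists z, [/\ I z, B x <= B z & C y <= C z])%E ->
  (forall x, I x -> [/\ A x = B x + C x, B x \is a fin_num & C x \is a fin_num])%E ->
  (ereal_sup [set B x | x in I] < +oo)%E ->
  (ereal_sup [set A x | x in I] - ereal_sup [set B x | x in I] = ereal_sup [set C x | x in I])%E.
Proof.
move=> [x0 Ix0] dir fin; set SA := ereal_sup [set A x | x in I].
set SB := ereal_sup [set B x | x in I]; set SC := ereal_sup [set C x | x in I] => SBy.
have leA x : I x -> (A x <= SA)%E by move=> Ix; apply: ereal_sup_ubound; exists x.
have leB x : I x -> (B x <= SB)%E by move=> Ix; apply: ereal_sup_ubound; exists x.
have leC x : I x -> (C x <= SC)%E by move=> Ix; apply: ereal_sup_ubound; exists x.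
have SBfin : SB \is a fin_num.
  have [_ Bx0 _] := fin _ Ix0; rewrite fin_numElt SBy andbT.
  by apply: lt_le_trans (leB _ Ix0); move: Bx0; rewrite fin_numElt => /andP[].
apply/eqP; rewrite eq_le; apply/andP; split.
  rewrite leeBlDr//; apply/ereal_supP => _ [x Ix <-].
  by have [-> _ _] := fin _ Ix; rewrite addeC leeD// ?leB ?leC.
apply/ereal_supP => _ [y Iy <-]; have [_ _ Cy] := fin _ Iy.
rewrite leeBrDr// addeC -leeBrDr//; apply/ereal_supP => _ [x Ix <-].
rewrite leeBrDr//; have [z [Iz Bz Cz]] := dir _ _ Ix Iy.
apply: le_trans (leA _ Iz); have [-> _ _] := fin _ Iz.
exact: leeD.
Qed.

Local Open Scope ereal_scope.

Theorem mainTheorem3 (R : realType) (mu : probability (cylR R) R) :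
  lebesgue_process mu ->
  nondegenerate_process mu ->
  (exists muG : probability (cylR R) R,
      gauss_process muG /\ nondegenerate_process muG /\ KLp mu muG < +oo) ->
  forall nu : probability (cylR R) R,
    gauss_process nu -> nondegenerate_process nu ->
  forall xi : probability (cylR R) R, is_GP_of mu xi ->
    KLp mu xi < +oo /\ KLp mu nu - KLp mu xi = gauss_div_p mu nu.
Proof.
move=> _ nmu [muG [gG [nG KLG]]] nu gnu nnu xi [gxi [xim xic]].
have mE n (x : n.-tuple R) i : fd_mean (fdd x mu) i = fd_mean (fdd x xi) i.
  by rewrite !fd_mean_fdd xim.
have cE n (x : n.-tuple R) i j : fd_cov (fdd x mu) i j = fd_cov (fdd x xi) i j.
  by rewrite !fd_cov_fdd xic.
(* Positivity is inherited from [mu] through the common covariance; square integrability comes from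
   [xi] being Gaussian. *)
have nxi : nondegenerate_process xi.
  move=> n x Ix; split.
    exact: (gaussian_second_moments (Q := fdd_prob x xi) (gxi _ _ Ix)).
  move=> v v0; have [_ /(_ v v0)] := nmu _ _ Ix.
  by under eq_bigr do under eq_bigr do rewrite cE.
have KLGx n (x : n.-tuple R) : in_I x -> KL (fdd x mu) (fdd x muG) < +oo.
  move=> Ix; apply: le_lt_trans KLG; apply: ereal_sup_ubound.
  by exists n, x.
have f2 n (x : n.-tuple R) : in_I x -> finite_second_moments (fdd_prob x mu).
  by move=> Ix; have [] := nmu _ _ Ix.
have KLxi n (x : n.-tuple R) : in_I x -> KL (fdd x mu) (fdd x xi) < +oo.
  move=> Ix; exact: (KL_gaussian_lty (P := fdd_prob x mu) (H := fdd_prob x muG)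
    (G := fdd_prob x xi) (f2 _ _ Ix) (gG _ _ Ix) (gxi _ _ Ix) (nG _ _ Ix) (nxi _ _ Ix) (KLGx _ _ Ix)).
have pyth n (x : n.-tuple R) (N : probability (cylR R) R) : in_I x ->
    gauss_process N -> nondegenerate_process N ->
    KL (fdd x mu) (fdd x N) = KL (fdd x mu) (fdd x xi) + KL (fdd x xi) (fdd x N) /\
    KL (fdd x xi) (fdd x N) \is a fin_num.
  move=> Ix gN nN; exact: (KL_pythagoras (P := fdd_prob x mu) (G := fdd_prob x xi)
    (Q := fdd_prob x N) (f2 _ _ Ix) (gxi _ _ Ix) (gN _ _ Ix) (nxi _ _ Ix) (nN _ _ Ix)
    (mE _ x) (cE _ x) (KLxi _ _ Ix)).
have gdE n (x : n.-tuple R) : in_I x ->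
    gauss_div (fdd x mu) (fdd x nu) = KL (fdd x xi) (fdd x nu).
  move=> Ix; exact: (gauss_divE (P := fdd_prob x mu) (G := fdd_prob x xi)
    (Q := fdd_prob x nu) (nmu _ _ Ix) (gxi _ _ Ix) (gnu _ _ Ix) (nxi _ _ Ix) (nnu _ _ Ix)
    (mE _ x) (cE _ x) (KLxi _ _ Ix)).
(* Tuples of all lengths are gathered in one type, so that the suprema run over a single directed
   index set. *)
pose J := {n & n.-tuple R}.
pose I : set J := [set z | in_I (projT2 z)].
have supE (F : forall n, n.-tuple R -> \bar R) :
    ereal_sup [set y | exists n (x : n.-tuple R), in_I x /\ y = F n x] =
    ereal_sup [set F _ (projT2 z) | z in I].
  congr ereal_sup; apply/seteqP; split => y.
    by move=> [n [x [Ix ->]]]; exists (existT _ n x).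
  by move=> [[n x] Ix <-]; exists n, x.
(* At each tuple [KL (fdd x muG)] from [mu] exceeds the divergence to [xi] by a nonnegative term, so
   the supremum for [muG] is a uniform bound. *)
have xi_lty : KLp mu xi < +oo.
  apply: le_lt_trans KLG; apply/ereal_supP => _ [n [x [Ix ->]]].
  apply: le_trans (ereal_sup_ubound _); last by exists n, x; split.
  have [-> _] := pyth _ _ _ Ix gG nG.
  by rewrite leeDl// (KL_ge0 (fdd_prob x xi) (fdd_prob x muG)).
split=> //.
rewrite /KLp /gauss_div_p.
rewrite (supE (fun n x => KL (fdd x mu) (fdd x nu))).
rewrite (supE (fun n x => gauss_div (fdd x mu) (fdd x nu))).
move: xi_lty; rewrite /KLp (supE (fun n x => KL (fdd x mu) (fdd x xi))) => xi_lty.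
apply: directed_sup_add => //.
- by exists (existT _ 1%N [tuple 0%R]).
- move=> [k x] [l y] /= Ix Iy; have [n [z [Iz xz yz]]] := in_I_directed Ix Iy.
  exists (existT _ n z); split=> //=; first by apply: KL_fdd_le => //; exact: KLxi.
  rewrite !gdE//; apply: KL_fdd_le => //.
  by rewrite ltey_eq; have [_ ->] := pyth _ _ _ Iy gnu nnu.
- move=> [n x] /= Ix; rewrite gdE//; have [-> Cfin] := pyth _ _ _ Ix gnu nnu.
  split=> //; rewrite ge0_fin_numE ?KLxi//.
  exact: (KL_ge0 (fdd_prob x mu) (fdd_prob x xi)).
Qed.
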